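(* Let $w=(w_i)_{i=1}^\infty\in(0,\infty)^{\mathbb N}$ be a weight and let $\mathcal B$ be a Schauder basis in a Banach space $\mathbb X$ over $\mathbb F\in\{\mathbb R,\mathbb C\}$, with basis constant $\mathfrak K_b$. a) If $\mathcal B$ is $C_{sg}$-$w$-semi-greedy, then $\mathcal B$ is $C_q$-quasi-greedy and $C_s$-$w$-super-democratic with $$C_q\le C_{sg}\mathfrak K_b\bigl(1+(1+\mathfrak K_b)C_{sg}+c_2^2\bigr),\qquad C_s\le\mathfrak K_bC_{sg}\bigl((1+\mathfrak K_b)C_{sg}+c_2^2\bigr).$$ b) If $\mathcal B$ is $C_q$-quasi-greedy and $C_s$-$w$-super-democratic, then $\mathcal B$ is $C_{sg}$-$w$-semi-greedy with $$C_{sg}\le C_q+4C_qC_s.$$ c) If $\mathcal B$ is $C_q$-quasi-greedy and $C_{sd}$-$w$-disjoint-super-democratic, then $\mathcal B$ is $C_{sg}$-$w$-semi-greedy with $$C_{sg}\le C_q+4C_q^2C_{sd}.$$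
   Context: Basis: a sequence $\mathcal B=(e_n)_{n\ge1}$ in $\mathbb X$ with biorthogonal functionals $(e_n^* )_{n\ge1}\subset\mathbb X^*$ which is a semi-normalized strong Markushevich basis, i.e. (a) $0<c_1:=\inf_n\{\|e_n\|,\|e_n^*\|\}\le\sup_n\{\|e_n\|,\|e_n^*\|\}=:c_2<\infty$; (b) $e_j^*(e_i)=\delta_{j,i}$; (c) $\mathbb X=\overline{\mathrm{span}}\{e_i:i\in\mathbb N\}$; (d) if $e_j^*(x)=0$ for all $j$ then $x=0$; (e) for every $A\subset\mathbb N$, $\overline{\mathrm{span}}\{e_i:i\in A\}=\{x\in\mathbb X: e_j^*(x)=0\ \forall j\notin A\}$. A Schauder basis is a basis in this sense with $\mathfrak K_b:=\sup_m\|P_m\|<\infty$, where $P_m(x)=\sum_{j=1}^me_j^*(x)e_j$. A sign is a sequence $\varepsilon=(\varepsilon_n)$ of scalars in $\mathbb F$ with $|\varepsilon_n|=1$; for finite $A\subset\mathbb N$, $\mathbf 1_{\varepsilon A}=\sum_{n\in A}\varepsilon_ne_n$. $\mathbb N^{<\infty}$ is the set of finite subsets of $\mathbb N$, and $w(A)=\sum_{i\in A}w_i$. Greedy sums: for $x\in\mathbb X$, the natural greedy ordering lists indices so that $|e_n^*(x)|$ is non-increasing, with ties broken by putting the smaller index first; $A_m(x)$ is the set of the first $m$ indices, and $\mathcal G_m(x)=\sum_{n\in A_m(x)}e_n^*(x)e_n$. The $m$-th Chebyshev-greedy sum $\mathcal{CG}_m(x)$ is any element of $\mathrm{span}\{e_i:i\in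 A_m(x)\}$ with $\|x-\mathcal{CG}_m(x)\|=\min\{\|x-\sum_{n\in A_m(x)}a_ne_n\|:a_n\in\mathbb F\}$. $\mathcal B$ is quasi-greedy if there is $C>0$ with $\|x-\mathcal G_m(x)\|\le C\|x\|$ for all $x\in\mathbb X$, $m\in\mathbb N$; the least such $C$ is denoted $C_q$ (''$C_q$-quasi-greedy''). $\mathcal B$ is $w$-semi-greedy if there is $C>0$ with $\|x-\mathcal{CG}_m(x)\|\le C\,\sigma^w_{w(A_m(x))}(x)$ for all $x\in\mathbb X$, $m\in\mathbb N$, where $\sigma^w_\delta(x)=\inf\{\|x-\sum_{n\in A}a_ne_n\|:A\in\mathbb N^{<\infty},\ w(A)\le\delta,\ a_n\in\mathbb F\}$; the least such $C$ is denoted $C_{sg}$. $\mathcal B$ is $w$-super-democratic if there is $C>0$ with $\|\mathbf 1_{\varepsilon A}\|\le C\|\mathbf 1_{\varepsilon'B}\|$ for all $A,B\in\mathbb N^{<\infty}$ with $w(A)\le w(B)$ and all signs $\varepsilon,\varepsilon'$; the least such $C$ is denoted $C_s$. If the inequality is required only for such $A,B$ with $A\cap B=\emptyset$, $\mathcal B$ is $w$-disjoint-super-democratic, and the least constant is denoted $C_{sd}$. *)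

(* Defs.v *)
From HB Require Import structures.
From mathcomp Require Import all_boot all_order all_algebra finmap complex.
From mathcomp Require Import all_classical all_reals all_analysis.

Set Implicit Arguments.
Unset Strict Implicit.
Unset Printing Implicit Defensive.

Import Order.TTheory GRing.Theory Num.Theory.
Import numFieldNormedType.Exports.

Local Open Scope classical_set_scope.
Local Open Scope ring_scope.

(* Everything is set up over an arbitrary [K : numFieldType], to be instantiated
   by R or R[i].  Norms and constants live in K; in R[i] the relation [x <= y]
   forces [y - x] to be real, so [0 < C] makes C a positive real number, and
   [supremum]/[infimum] of a nonempty set of reals agree with those taken
   in R.
   Sequences (e_n)_{n >= 1} are indexed from 0; numbers m of terms are >= 1. *)

Definition is_least (K : numFieldType) (S : set K) (c : K) : Prop :=
  S c /\ lbound S c.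

Definition opnorm (K : numFieldType) (X Y : normedModType K) (f : X -> Y) : K :=
  supremum 0 [set `|f x| | x in [set x : X | `|x| <= 1]].

Definition weight (R : realType) (w : nat -> R) (A : {fset nat}) : R :=
  \sum_(i <- A) w i.

Section Bases.
Variables (K : numFieldType) (X : completeNormedModType K).
Variables (e : nat -> X) (es : nat -> {linear X -> K^o}).

Definition lincomb (A : {fset nat}) (a : nat -> K) : X :=
  \sum_(i <- A) a i *: e i.

Definition span_of (I : set nat) : set X :=
  [set x | exists (A : {fset nat}) (a : nat -> K),
     (forall i, i \in A -> I i) /\ x = lincomb A a].

Definition basis_norms : set K :=
  range (fun n => `|e n|) `|` range (fun n => opnorm (es n)).

Definition basis_c1 : K := infimum 0 basis_norms.
Definition basis_c2 : K := supremum 0 basis_norms.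

Definition strong_markushevich_basis : Prop :=
  [/\ forall j, continuous (es j),
      0 < basis_c1 /\ has_ubound basis_norms,
      forall i j, es j (e i) = (i == j)%:R,
      closure (span_of setT) = setT &
      (forall x, (forall j, es j x = 0) -> x = 0) /\
      (forall I : set nat,
         closure (span_of I) = [set x | forall j, ~ I j -> es j x = 0])].

Definition partial_sum (m : nat) (x : X) : X := \sum_(j < m) es j x *: e j.

Definition partial_sum_norms : set K :=
  [set opnorm (partial_sum m) | m in [set m | (0 < m)%N]].

Definition basis_constant : K := supremum 0 partial_sum_norms.

Definition schauder_basis : Prop :=
  strong_markushevich_basis /\ has_ubound partial_sum_norms.

Definition is_sign (eps : nat -> K) : Prop := forall n, `|eps n| = 1.

Definition greedy_before (x : X) (i j : nat) : Prop :=
  `|es j x| < `|es i x| \/ (`|es j x| = `|es i x| /\ (i < j)%N).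

(* The coefficients of x tend to 0, so there is exactly one set of m indices
   preceding all the others; the default value of [xget] is never used. *)
Definition greedy_set (m : nat) (x : X) : {fset nat} :=
  xget fset0 [set A : {fset nat} | #|` A| = m /\
    forall i j, i \in A -> j \notin A -> greedy_before x i j].

Definition greedy_sum (m : nat) (x : X) : X :=
  lincomb (greedy_set m x) (fun n => es n x).

Definition is_chebyshev_greedy_sum (m : nat) (x y : X) : Prop :=
  (exists a, y = lincomb (greedy_set m x) a) /\
  (forall a, `|x - y| <= `|x - lincomb (greedy_set m x) a|).

Definition quasi_greedy_constants : set K :=
  [set C | 0 < C /\
     forall (x : X) (m : nat), (0 < m)%N -> `|x - greedy_sum m x| <= C * `|x|].

Section Weighted.
Variables (R : realType) (w : nat -> R).

Definition sigma (delta : R) (x : X) : K :=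
  infimum 0 [set r | exists (A : {fset nat}) (a : nat -> K),
    weight w A <= delta /\ r = `|x - lincomb A a|].

Definition semi_greedy_constants : set K :=
  [set C | 0 < C /\
     forall (x y : X) (m : nat), (0 < m)%N -> is_chebyshev_greedy_sum m x y ->
       `|x - y| <= C * sigma (weight w (greedy_set m x)) x].

Definition super_democratic_constants : set K :=
  [set C | 0 < C /\
     forall (A B : {fset nat}) (eps eps' : nat -> K),
       weight w A <= weight w B -> is_sign eps -> is_sign eps' ->
       `|lincomb A eps| <= C * `|lincomb B eps'|].

Definition disjoint_super_democratic_constants : set K :=
  [set C | 0 < C /\
     forall (A B : {fset nat}) (eps eps' : nat -> K),
       weight w A <= weight w B -> [disjoint A & B]%fset ->
       is_sign eps -> is_sign eps' ->
       `|lincomb A eps| <= C * `|lincomb B eps'|].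

End Weighted.
End Bases.

(* Main.v *)
(* If [y] is obtained from [v] by changing coefficients on a set [H], and is then
   optimised on a set [G] disjoint from [H], with [w(H) <= w(G)] and the
   coefficients of [v] on [G] dominating all others, then the semi-greedy property
   gives [N y <= s N v]: [H] may be prescribed at the price of losing control on [G].
   For a Schauder basis one then recovers the part on which nothing was lost by a
   partial sum or a tail.
   - Quasi-greediness: exchange the two halves of a greedy set, cut at a weighted
     median; the partial sum of one result and the tail of the other add up to the
     greedy remainder.
   - Super-democracy: take the crossing index [q] at which the weight of [A] to the
     left of [q] stops being dominated by the weight of [B] to its right.  The parts
     of [1_A] on both sides of [q] come from [1_B] by exchanges with the part of [B]
     on the other side; averaging over the signs of [1_B] erases leftovers, and
     distinguishing whether [q] lies in [A] or in [B] saves the stray term [e_q].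
   - Conversely, let [z] be supported in [B] with [w(B) <= w(A)], [A] greedy for [x],
     and truncate [v = x - z] at height [t = min_A |x_n|].  The truncation has norm
     at most [Cq N v]; correcting it on [B \ A] costs [2 t N(1_{eps (B \ A)})], which
     democracy compares with [t N(1_L) <= 2 Cq N v], [L] being the level set of [v]
     at height [t], which contains [A \ B].  The result differs from [x] on [A] only. *)
Require Import Defs.
From HB Require Import structures.
From mathcomp Require Import all_boot all_order all_algebra finmap complex.
From mathcomp Require Import all_classical all_reals all_analysis.
From mathcomp Require Import ring lra.

Import Order.TTheory GRing.Theory Num.Theory.
Import numFieldNormedType.Exports.

Local Open Scope classical_set_scope.
Local Open Scope ring_scope.

Set Implicit Arguments.
Unset Strict Implicit.
Unset Printing Implicit Defensive.

(** * Real-valued norms *)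

(* Treats [K = R] and [K = R[i]] at once: [i] embeds the reals, [re] is its
   inverse on real scalars, and [K] is [i R + u * i R] for some [u]. *)
Definition real_scalars (R : realType) (K : numFieldType)
    (i : {rmorphism R -> K}) (re : K -> R) : Prop :=
  [/\ {mono i : x y / x <= y},
      forall k, k \is Num.real -> i (re k) = k &
      exists u : K, forall k, exists a b : R,
        [/\ `|a| <= re `|k|, `|b| <= re `|k| & k = i a + u * i b]].

Lemma real_scalars_real (R : realType) :
  exists (i : {rmorphism R -> R}) (re : R -> R), real_scalars i re.
Proof.
exists (idfun : {rmorphism R -> R}), idfun; split => //.
exists 0 => k; exists k, 0; split => //=.
- by rewrite normr0.
- by rewrite mulr0 addr0.
Qed.

Lemma real_scalars_complex (R : realType) :
  exists (i : {rmorphism R -> R[i]%C}) (re : R[i]%C -> R), real_scalars i re.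
Proof.
exists (real_complex R : {rmorphism R -> R[i]%C}), (@complex.Re R); split.
- by move=> x y; rewrite lecR.
- by move=> k /complex_realP[x ->].
exists 'i%C => k; exists (complex.Re k), (complex.Im k).
have nE : `|k| = (complex.Re `|k|)%:C%C.
  by have /complex_realP[x ->] := normr_real k.
split; last exact: complexE.
- by rewrite -lecR -nE normc_ge_Re.
- rewrite -lecR -nE; have := normc_ge_Re ('i%C * k).
  rewrite normrM (_ : `|'i%C| = 1 :> R[i]%C) ?mul1r; last first.
    by rewrite normc_def /= expr0n /= add0r expr1n sqrtr1.
  by case: k {nE} => a b /=; rewrite mul0r mul1r sub0r normrN.
Qed.

Section RealNorm.
Variables (R : realType) (K : numFieldType) (i : {rmorphism R -> K}).
Variables (re : K -> R).
Hypothesis iP : real_scalars i re.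

Let i_le x y : (i x <= i y) = (x <= y). Proof. by case: iP => /(_ x y). Qed.

Lemma scalar_inj : injective i.
Proof. by move=> x y e; apply/eqP; rewrite eq_le -!i_le e lexx. Qed.

Lemma scalar_lt x y : (i x < i y) = (x < y).
Proof. by rewrite !lt_neqAle i_le (inj_eq scalar_inj). Qed.

Lemma scalar_re k : k \is Num.real -> i (re k) = k.
Proof. by case: iP => _ /(_ k). Qed.

Lemma scalar_real x : i x \is Num.real.
Proof.
by case: (leP 0 x) => [|/ltW] h; rewrite realE -(rmorph0 i) !i_le h ?orbT.
Qed.

Lemma re_scalar x : re (i x) = x.
Proof. by apply: scalar_inj; rewrite scalar_re ?scalar_real. Qed.

Definition rnorm (V : normedZmodType K) (x : V) : R := re `|x|.

Lemma scalar_rnorm (V : normedZmodType K) (x : V) : i (rnorm x) = `|x|.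
Proof. by rewrite /rnorm scalar_re ?normr_real. Qed.

Lemma le_rnorm (V W : normedZmodType K) (x : V) (y : W) :
  (`|x| <= `|y|) = (rnorm x <= rnorm y).
Proof. by rewrite -!scalar_rnorm i_le. Qed.

Lemma lt_rnorm (V W : normedZmodType K) (x : V) (y : W) :
  (`|x| < `|y|) = (rnorm x < rnorm y).
Proof. by rewrite -!scalar_rnorm scalar_lt. Qed.

Lemma rnorm_ge0 (V : normedZmodType K) (x : V) : 0 <= rnorm x.
Proof. by rewrite -i_le rmorph0 scalar_rnorm. Qed.

Lemma rnorm0 (V : normedZmodType K) : rnorm (0 : V) = 0.
Proof. by apply: scalar_inj; rewrite scalar_rnorm rmorph0 normr0. Qed.

Lemma rnorm0_eq0 (V : normedZmodType K) (x : V) : rnorm x = 0 -> x = 0.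
Proof. by move=> /(congr1 i); rewrite scalar_rnorm rmorph0 => /normr0_eq0. Qed.

Lemma rnormN (V : normedZmodType K) (x : V) : rnorm (- x) = rnorm x.
Proof. by rewrite /rnorm normrN. Qed.

Lemma ler_rnormD (V : normedZmodType K) (x y : V) :
  rnorm (x + y) <= rnorm x + rnorm y.
Proof. by rewrite -i_le rmorphD !scalar_rnorm ler_normD. Qed.

Lemma ler_rnormBD (V : normedZmodType K) (x y : V) :
  rnorm (x - y) <= rnorm x + rnorm y.
Proof. by rewrite -(rnormN y) ler_rnormD. Qed.

Lemma ler_rnorm_sum (V : normedZmodType K) (I : Type) (r : seq I) (F : I -> V) :
  rnorm (\sum_(j <- r) F j) <= \sum_(j <- r) rnorm (F j).
Proof.
rewrite -i_le scalar_rnorm rmorph_sum; apply: (le_trans (ler_norm_sum _ _ _)).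
by apply: ler_sum => j _; rewrite scalar_rnorm.
Qed.

Lemma rnormM (x y : K) : rnorm (x * y) = rnorm x * rnorm y.
Proof. by apply: scalar_inj; rewrite rmorphM !scalar_rnorm normrM. Qed.

Lemma rnorm1 : rnorm (1 : K) = 1.
Proof. by apply: scalar_inj; rewrite scalar_rnorm rmorph1 normr1. Qed.

Lemma rnormV (x : K) : rnorm x^-1 = (rnorm x)^-1.
Proof. by apply: scalar_inj; rewrite fmorphV !scalar_rnorm normfV. Qed.

Lemma rnorm_scalar x : rnorm (i x) = `|x|.
Proof.
apply: scalar_inj; rewrite scalar_rnorm; case: (leP 0 x) => h.
  by rewrite !ger0_norm // -(rmorph0 i) i_le.
by rewrite !ltr0_norm ?rmorphN // -(rmorph0 i) scalar_lt.
Qed.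

Lemma rnormZ (V : normedModType K) (k : K) (x : V) :
  rnorm (k *: x) = rnorm k * rnorm x.
Proof. by apply: scalar_inj; rewrite rmorphM !scalar_rnorm normrZ. Qed.

(** An upper bound of a nonempty set of reals is itself real, its difference with a member being
    nonnegative. Upper bounds in [K] thus correspond to those of the preimage [T], and completeness
    of [R] applies. *)
Lemma supremum_real (S : set K) : S !=set0 ->
  (forall k, S k -> k \is Num.real) -> has_ubound S ->
  exists r, [/\ supremum 0 S = i r, forall k, S k -> k <= i r &
    forall M, (forall k, S k -> k <= i M) -> r <= M].
Proof.
move=> S0 Sr [B SB]; pose T := [set x | S (i x)].
have T0 : T !=set0.
  by case: S0 => k Sk; exists (re k); rewrite /T /= scalar_re ?Sr.
have ubT (M : K) : (forall k, S k -> k <= M) -> ubound T (re M) /\ i (re M) = M.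
  move=> SM; have Mr : M \is Num.real.
    case: S0 => k Sk; rewrite -(subrK k M); apply: rpredD; last exact: Sr.
    by rewrite ger0_real // subr_ge0 SM.
  rewrite scalar_re //; split => // x Tx.
  by rewrite -i_le scalar_re // SM.
have supT : has_sup T by split => //; exists (re B); apply: (ubT B SB).1.
have ub k : S k -> k <= i (sup T).
  move=> Sk; rewrite -(scalar_re (Sr _ Sk)) i_le; apply: ub_le_sup => //.
    exact: supT.2.
  by rewrite /T /= scalar_re ?Sr.
have lub (M : K) : (forall k, S k -> k <= M) -> i (sup T) <= M.
  move=> /ubT[h <-]; rewrite i_le; exact: ge_sup.
exists (sup T); split => //.
  rewrite /supremum ifF; last by apply/negbTE/set0P.
  apply: xget_unique; first by split.
  move=> y [uy ly]; apply/eqP; rewrite eq_le lub // andbT.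
  exact: ly.
by move=> M /lub; rewrite i_le.
Qed.

Lemma infimum_real (S : set K) : S !=set0 -> (forall k, S k -> 0 <= k) ->
  exists r, [/\ infimum 0 S = i r, 0 <= r, forall k, S k -> i r <= k &
    forall M, (forall k, S k -> i M <= k) -> M <= r].
Proof.
move=> S0 Sge.
have Sr k : S k -> k \is Num.real by move=> /Sge/ger0_real.
have [|||r [_ r1 r2]] := @supremum_real [set - k | k in S].
- by case: S0 => k Sk; exists (- k), k.
- by move=> _ [k Sk <-]; rewrite rpredN Sr.
- by exists 0 => _ [k Sk <-]; rewrite oppr_le0 Sge.
have lb k : S k -> i (- r) <= k.
  by move=> Sk; rewrite rmorphN lerNl r1 //; exists k.
have glb (M : K) : (forall k, S k -> M <= k) -> M <= i (- r).
  move=> SM; have Mr : M \is Num.real.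
    case: S0 => k Sk; rewrite -(subrK k M); apply: rpredD; last exact: Sr.
    by rewrite -opprB rpredN ger0_real // subr_ge0 SM.
  rewrite -(scalar_re Mr) i_le lerNr; apply: r2 => _ [k Sk <-].
  by rewrite rmorphN lerN2 scalar_re // SM.
exists (- r); split => //.
- rewrite /infimum ifF; last by apply/negbTE/set0P.
  apply: xget_unique; first by split.
  move=> y [uy ly]; apply/eqP; rewrite eq_le glb //=.
  exact: ly.
- by rewrite -i_le rmorph0 glb.
- by move=> M /glb; rewrite i_le.
Qed.

(** The condition is closed in [C], so the infimum of the admissible constants satisfies it too. The
    point with [f t > 0] keeps this infimum positive, as membership demands. *)
Lemma least_constant (T : Type) (P : T -> Prop) (f g : T -> R) (C0 : R) :
  (forall t, 0 <= g t) -> 0 < C0 -> (forall t, P t -> f t <= C0 * g t) ->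
  (exists2 t, P t & 0 < f t) ->
  exists2 c : R, c <= C0 &
    is_least [set C : K | 0 < C /\ forall t, P t -> i (f t) <= C * i (g t)] (i c).
Proof.
move=> g0 C00 C0P [t0 Pt0 f0].
pose S := [set C : R | 0 < C /\ forall t, P t -> f t <= C * g t].
have S0 : S !=set0 by exists C0.
have lbS : has_lbound S by exists 0 => x [/ltW].
have infP : has_inf S by [].
have cP t : P t -> f t <= inf S * g t.
  (* Where [g t = 0] one cannot divide; the inequality then reads [f t <= 0], which [C0] already
     gives. *)
  move=> Pt; have := g0 t; rewrite le_eqVlt => /predU1P[gt|gt].
    by have := C0P t Pt; rewrite -gt !mulr0.
  rewrite -ler_pdivrMr //; apply: lb_le_inf => // C [_ /(_ t Pt)].
  by rewrite ler_pdivrMr.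
have c0 : 0 < inf S.
  have := cP _ Pt0 => h; rewrite ltNge; apply/negP => c0.
  have : inf S * g t0 <= 0 by rewrite mulr_le0_ge0.
  by move=> h2; have := lt_le_trans f0 (le_trans h h2); rewrite ltxx.
exists (inf S); first by apply: ge_inf.
split; first split.
- by rewrite -(rmorph0 i) scalar_lt.
- by move=> t Pt; rewrite -rmorphM i_le cP.
move=> C [C1 C2]; have Cr : C \is Num.real by rewrite gtr0_real.
rewrite -(scalar_re Cr) i_le; apply: ge_inf => //; split.
  by rewrite -scalar_lt rmorph0 scalar_re.
by move=> t /C2; rewrite -{1}(scalar_re Cr) -rmorphM i_le.
Qed.

End RealNorm.

(** * Coordinates and basis constants *)

Section Basis.
Variables (R : realType) (K : numFieldType) (i : {rmorphism R -> K}).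
Variables (re : K -> R).
Hypothesis iP : real_scalars i re.
Variables (X : completeNormedModType K).
Variables (e : nat -> X) (es : nat -> {linear X -> K^o}).
Hypothesis hB : schauder_basis e es.

Local Notation N := (rnorm re).

Definition coord (j : nat) (x : X) : K := es j x.

Lemma coordD j x y : coord j (x + y) = coord j x + coord j y.
Proof. by rewrite /coord raddfD. Qed.

Lemma coordN j x : coord j (- x) = - coord j x.
Proof. by rewrite /coord raddfN. Qed.

Lemma coordB j x y : coord j (x - y) = coord j x - coord j y.
Proof. by rewrite /coord raddfB. Qed.

Lemma coordZ j k x : coord j (k *: x) = k * coord j x.
Proof. by rewrite /coord linearZ. Qed.

Lemma coord0 j : coord j 0 = 0.
Proof. by rewrite /coord raddf0. Qed.

Lemma coord_sum j (I : Type) (r : seq I) (F : I -> X) :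
  coord j (\sum_(k <- r) F k) = \sum_(k <- r) coord j (F k).
Proof. by rewrite /coord raddf_sum. Qed.

Lemma coord_basis j k : coord j (e k) = (j == k)%:R.
Proof. by case: hB => -[_ _ h _ _] _; rewrite /coord h eq_sym. Qed.

Lemma coord_ext x y : (forall j, coord j x = coord j y) -> x = y.
Proof.
move=> h; case: hB => -[_ _ _ _ [tot _]] _.
apply/eqP; rewrite -subr_eq0; apply/eqP/tot => j.
by rewrite -[LHS]/(coord j (x - y)) coordB h subrr.
Qed.

Lemma coord_lincomb j (A : {fset nat}) a :
  coord j (lincomb e A a) = if j \in A then a j else 0.
Proof.
rewrite /lincomb coord_sum; under eq_bigr do rewrite coordZ coord_basis.
case: ifPn => jA.
  rewrite (big_fsetD1 j) //= eqxx mulr1 big_seq big1 ?addr0 // => k.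
  by rewrite !inE eq_sym => /andP[/negbTE -> _]; rewrite mulr0.
rewrite big_seq big1 // => k kA; case: eqP => [jk|]; rewrite ?mulr0 //.
by rewrite jk kA in jA.
Qed.

Lemma coord_partial_sum j m x :
  coord j (partial_sum e es m x) = if (j < m)%N then coord j x else 0.
Proof.
rewrite /partial_sum coord_sum.
under eq_bigr do rewrite coordZ coord_basis -/(coord _ _).
case: ltnP => jm.
  rewrite (bigD1 (Ordinal jm)) //= eqxx mulr1 big1 ?addr0 // => k.
  rewrite -val_eqE /= eq_sym => /negbTE ->; exact: mulr0.
rewrite big1 // => k _; case: eqP => [jk|]; rewrite ?mulr0 //.
by move: (ltn_ord k); rewrite -jk ltnNge jm.
Qed.

(** The a priori bound [B] makes the supremum over the unit ball finite; homogeneity then extends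
    the estimate to all vectors. *)
Lemma opnorm_real (Y : normedModType K) (f : X -> Y) (B : R) :
  (forall k x, f (k *: x) = k *: f x) ->
  (forall x, N (f x) <= B * N x) ->
  exists r, opnorm f = i r /\ forall x, N (f x) <= r * N x.
Proof.
move=> fZ fB; rewrite /opnorm.
have [|||r [-> r1 _]] := @supremum_real _ _ _ _ iP
    [set `|f x| | x in [set x : X | `|x| <= 1]].
- by exists `|f 0|, 0 => //=; rewrite normr0.
- by move=> _ [x _ <-]; exact: normr_real.
- exists (i `|B|) => _ [x /= x1 <-]; rewrite -(scalar_rnorm iP).
  case: (iP) => -> _ _; apply: (le_trans (fB x)).
  have x1' : N x <= 1.
    by case: (iP) => <- _ _; rewrite scalar_rnorm // rmorph1.
  apply: (@le_trans _ _ (`|B| * N x)).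
    by rewrite ler_wpM2r ?ler_norm // (rnorm_ge0 iP).
  by rewrite ler_piMr.
exists r; split => // x.
have [->|x0] := eqVneq x 0.
  have -> : f 0 = 0 by have := fZ 0 0; rewrite !scale0r.
  by rewrite !(rnorm0 iP) mulr0.
have Nx : 0 < N x.
  rewrite lt_def (rnorm_ge0 iP) andbT; apply/eqP => /(rnorm0_eq0 iP) h.
  by rewrite h eqxx in x0.
have h : [set `|f x| | x in [set x : X | `|x| <= 1]] `|f (`|x|^-1 *: x)|.
  by exists (`|x|^-1 *: x) => //=; rewrite normrZ normfV normr_id mulVf // normr_eq0.
move/r1: h; rewrite -(scalar_rnorm iP).
case: (iP) => -> _ _; rewrite fZ (rnormZ iP) (rnormV iP).
rewrite -(scalar_rnorm iP) (rnorm_scalar iP) (ger0_norm (ltW Nx)).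
by rewrite mulrC ler_pdivrMr.
Qed.

Lemma coord_bounded j : exists B : R, forall x, N (coord j x) <= B * N x.
Proof.
case: hB => -[/(_ j)/(_ 0)/continuous_linear_bounded/linear_boundedP h _ _ _ _] _.
case: h => M [Mr /(_ (M + 1))]; rewrite ltrDl ltr01 => /(_ isT) h.
have r1 : M + 1 \is Num.real by rewrite rpredD ?Mr ?real1.
exists (re (M + 1)) => x; case: (iP) => <- _ _.
by rewrite rmorphM !scalar_rnorm // (scalar_re iP r1) h.
Qed.

Lemma basis_constants : exists c Kb : R,
  [/\ basis_c2 e es = i c, basis_constant e es = i Kb,
      forall n, N (e n) <= c, forall n x, N (coord n x) <= c * N x &
      forall m x, N (partial_sum e es m x) <= Kb * N x].
Proof.
have opE n : exists r, opnorm (es n) = i r /\ forall x, N (coord n x) <= r * N x.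
  have [B hb] := coord_bounded n.
  apply: (@opnorm_real K^o (es n) B); last exact: hb.
  by move=> k x; exact: linearZ.
have PZ m k x : partial_sum e es m (k *: x) = k *: partial_sum e es m x.
  rewrite /partial_sum scaler_sumr; apply: eq_bigr => j _.
  by rewrite scalerA; congr (_ *: _); exact: coordZ.
have PB m : exists B : R, forall x, N (partial_sum e es m x) <= B * N x.
  have /choice[B hb] := coord_bounded.
  exists (\sum_(j < m) B j * N (e j)) => x.
  rewrite mulr_suml; apply: (le_trans (ler_rnorm_sum iP _ _)).
  apply: ler_sum => j _; rewrite (rnormZ iP) mulrAC.
  by rewrite ler_wpM2r ?(rnorm_ge0 iP) // hb.
have PE m : exists r, opnorm (partial_sum e es m) = i r /\
    forall x, N (partial_sum e es m x) <= r * N x.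
  have [B hb] := PB m; exact: (@opnorm_real X _ B (PZ m) hb).
case: (hB) => -[_ [_ ub1] _ _ _] ub2.
have [|||c [cE c1 _]] := @supremum_real _ _ _ _ iP (basis_norms e es).
- by exists `|e 0|; left; exists 0.
- move=> k [[n _ <-]|[n _ <-]]; first exact: normr_real.
  by have [r [-> _]] := opE n; exact: (scalar_real iP).
- exact: ub1.
have [|||Kb [KE K1 _]] := @supremum_real _ _ _ _ iP (partial_sum_norms e es).
- by exists (opnorm (partial_sum e es 1)), 1%N.
- move=> _ [m _ <-].
  by have [r [-> _]] := PE m; exact: (scalar_real iP).
- exact: ub2.
have Kb_ge m x : (0 < m)%N -> N (partial_sum e es m x) <= Kb * N x.
  move=> m0; have [r [rE r1]] := PE m.
  apply: (le_trans (r1 x)); rewrite ler_wpM2r ?(rnorm_ge0 iP) //.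
  by case: (iP) => <- _ _; rewrite -rE; apply: K1; exists m.
exists c, Kb; split => //.
- move=> n; case: (iP) => <- _ _; rewrite scalar_rnorm //.
  by apply: c1; left; exists n.
- move=> n x; have [r [rE r1]] := opE n.
  apply: (le_trans (r1 x)); rewrite ler_wpM2r ?(rnorm_ge0 iP) //.
  by case: (iP) => <- _ _; rewrite -rE; apply: c1; right; exists n.
(* The supremum runs over [m > 0]. For [m = 0] the partial sum vanishes, and [Kb * N x] is
   nonnegative by the case [m = 1]. *)
- case=> [|m] x; last exact: Kb_ge.
  rewrite /partial_sum big_ord0 (rnorm0 iP).
  by apply: le_trans (Kb_ge 1%N x isT); exact: (rnorm_ge0 iP).
Qed.

End Basis.

(** * Chebyshev approximants *)

Section Chebyshev.
Variables (R : realType) (K : numFieldType) (i : {rmorphism R -> K}).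
Variables (re : K -> R).
Hypothesis iP : real_scalars i re.
Variables (X : completeNormedModType K).

Local Notation N := (rnorm re).

(** The distance is Lipschitz in the coefficients, with constant [L], hence attains its minimum on
    the compact box. *)
Lemma real_box_minimum n (f : 'I_n -> X) (x : X) (M : R) : 0 <= M ->
  exists2 v : 'I_n -> R, (forall k, `|v k| <= M) &
    forall t, (forall k, `|t k| <= M) ->
      N (x - \sum_k i (v k) *: f k) <= N (x - \sum_k i (t k) *: f k).
Proof.
move=> M0; pose F (v : 'rV[R]_n) := N (x - \sum_k i (v ord0 k) *: f k).
pose L := \sum_k N (f k).
have L0 : 0 <= L by rewrite sumr_ge0 // => k _; exact: (rnorm_ge0 iP).
have lipF (v t : 'rV[R]_n) d : (forall k, `|v ord0 k - t ord0 k| <= d) ->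
    F v <= F t + L * d.
  move=> vt; rewrite /F.
  have -> : x - \sum_k i (v ord0 k) *: f k = (x - \sum_k i (t ord0 k) *: f k)
      + \sum_k i (t ord0 k - v ord0 k) *: f k.
    under [X in _ = _ + X]eq_bigr do rewrite rmorphB scalerBl.
    by rewrite sumrB addrA subrK.
  apply: (le_trans (ler_rnormD iP _ _)); rewrite lerD2l.
  apply: (le_trans (ler_rnorm_sum iP _ _)); rewrite /L mulr_suml.
  apply: ler_sum => k _; rewrite (rnormZ iP) (rnorm_scalar iP) mulrC.
  by rewrite ler_wpM2l ?(rnorm_ge0 iP) // distrC.
have contF : continuous F.
  move=> v W /nbhs_ballP[eps /= eps0 epsW]; apply/nbhs_ballP.
  (* [L + 1] replaces [L], which is 0 when all [f k] vanish. *)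
  have L1 : 0 < L + 1 by rewrite ltr_wpDl.
  exists (eps / (L + 1)); first by rewrite /= divr_gt0.
  move=> t [_ vt]; apply: epsW; rewrite /ball /=.
  have d k : `|v ord0 k - t ord0 k| <= eps / (L + 1).
    exact: ltW (vt ord0 k).
  have d' k : `|t ord0 k - v ord0 k| <= eps / (L + 1) by rewrite distrC.
  have h1 := lipF _ _ _ d; have h2 := lipF _ _ _ d'.
  have h3 : L * (eps / (L + 1)) < eps.
    rewrite mulrCA gtr_pMr // ltr_pdivrMr // mul1r ltrDl; exact: ltr01.
  rewrite ltr_norml; apply/andP; split; lra.
have [|||v /set_mem vM vmin] := @EVT_min_rV R n F
    [set v | forall k, `[(- M), M]%classic (v ord0 k)].
- by exists 0 => k; rewrite mxE /= in_itv /= oppr_le0 M0.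
- apply: (@rV_compact _ _ (fun=> `[(- M), M]%classic)) => k; exact: segment_compact.
- exact: continuous_subspaceT.
exists (v ord0) => [k|t tM].
  by have := vM k; rewrite /= in_itv /= ler_norml.
have := vmin (\row_k t k); rewrite /F; under [X in _ <= N (_ - X)]eq_bigr do rewrite mxE.
apply; apply/mem_set => k; by rewrite /= in_itv /= -ler_norml mxE.
Qed.

Variables (e : nat -> X) (es : nat -> {linear X -> K^o}).
Hypothesis hB : schauder_basis e es.
Local Notation co := (coord es).

Lemma lincomb_ord (A : {fset nat}) (a : nat -> K) m :
  (forall k, k \in A -> (k < m)%N) ->
  lincomb e A a = \sum_(j < m) a j *: (if val j \in A then e j else 0).
Proof.
move=> Am; apply: (coord_ext hB) => k; rewrite (coord_lincomb hB) coord_sum.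
case: ifPn => kA.
  rewrite (bigD1 (Ordinal (Am _ kA))) //= kA coordZ (coord_basis hB) eqxx.
  rewrite mulr1 big1 ?addr0 // => j; rewrite -val_eqE /= => jk.
  case: ifP => _; last by rewrite scaler0 coord0.
  by rewrite coordZ (coord_basis hB) eq_sym (negbTE jk) mulr0.
rewrite big1 // => j _; case: ifPn => jA; last by rewrite scaler0 coord0.
rewrite coordZ (coord_basis hB); case: eqP => [kj|_]; last by rewrite mulr0.
by rewrite kj jA in kA.
Qed.

(** A competitor no worse than 0 has norm at most [2 * N x], hence coefficients at most
    [2 * (c * N x)]. A minimum over the box of that size is therefore a minimum over the whole
    span. *)
Lemma chebyshev_exists (A : {fset nat}) (x : X) :
  exists a, forall b, N (x - lincomb e A a) <= N (x - lincomb e A b).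
Proof.
have [c [Kb [_ _ he hc _]]] := basis_constants iP hB.
have c0 : 0 <= c * N x.
  by apply: le_trans (hc 0 x); exact: (rnorm_ge0 iP).
have [iP1 iP2 [u uP]] := iP.
pose m := (\max_(k <- A) k).+1.
have Am k : k \in A -> (k < m)%N.
  by move=> kA; rewrite ltnS; apply: leq_bigmax_seq.
pose g (j : 'I_m) := if val j \in A then e j else 0.
(* A scalar [i p + u * i q] counts as two real coordinates: [f] lists the vectors [g j], then their
   multiples by [u]. *)
pose f (k : 'I_(m + m)) := match fintype.split k with
  inl j => g j | inr j => u *: g j end.
have sumf (p q : 'I_m -> R) : \sum_(k < m + m)
    i (match fintype.split k with inl j => p j | inr j => q j end) *: f k =
    \sum_(j < m) (i (p j) + u * i (q j)) *: g j.
  rewrite big_split_ord /= -big_split /=; apply: eq_bigr => j _.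
  rewrite /f !(unsplitK (inl j)) !(unsplitK (inr j)) scalerDl scalerA.
  by rewrite [u * _]mulrC.
have M0 : 0 <= 2 * (c * N x) by rewrite mulr_ge0.
have [v vM vmin] := @real_box_minimum (m + m) f x _ M0.
pose a k := if insub k is Some j then i (v (lshift m j)) + u * i (v (rshift m j))
  else 0.
have vE : lincomb e A a = \sum_k i (v k) *: f k.
  rewrite (lincomb_ord _ Am); transitivity (\sum_(k < m + m)
      i (match fintype.split k with
         inl j => v (lshift m j) | inr j => v (rshift m j) end) *: f k).
    rewrite (sumf (fun j => v (lshift m j)) (fun j => v (rshift m j))).
    by apply: eq_bigr => j _; rewrite /a valK.
  apply: eq_bigr => k _; congr (i _ *: _).
  by case: (splitP k) => j kj; congr (v _); apply: val_inj.
exists a => b; rewrite vE.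
have [big|small] := ltP (N x) (N (x - lincomb e A b)).
  apply: le_trans (ltW big); have := vmin (fun=> 0).
  under [X in _ -> _ <= N (_ - X)]eq_bigr do rewrite rmorph0 scale0r.
  rewrite big1_eq subr0; apply => k; by rewrite normr0.
have bM k : k \in A -> N (b k) <= 2 * (c * N x).
  move=> kA; have <- : co k (lincomb e A b) = b k by rewrite (coord_lincomb hB) kA.
  apply: (le_trans (hc _ _)).
  have nl : N (lincomb e A b) <= 2 * N x.
    have := ler_rnormBD iP x (x - lincomb e A b); rewrite subKr.
    by move=> h; apply: (le_trans h); rewrite mulrDl mul1r lerD2l.
  by rewrite mulrCA ler_wpM2l //; apply: le_trans (rnorm_ge0 iP (e 0)) (he 0).
have /choice[p /choice[q pqP]] : forall k, exists p q : R,
    [/\ `|p| <= N (b k), `|q| <= N (b k) & b k = i p + u * i q].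
  by move=> k; exact: uP.
pose p' k := if k \in A then p k else 0.
pose q' k := if k \in A then q k else 0.
have -> : lincomb e A b = \sum_k i (match fintype.split k with
    inl j => p' (val j) | inr j => q' (val j) end) *: f k.
  rewrite (lincomb_ord _ Am) (sumf (fun j => p' (val j)) (fun j => q' (val j))).
  apply: eq_bigr => j _; rewrite /g /p' /q'; case: ifP => jA; last by rewrite !scaler0.
  by have [_ _ <-] := pqP (val j).
apply: vmin => k.
have bd (j : nat) : `|p' j| <= 2 * (c * N x) /\ `|q' j| <= 2 * (c * N x).
  rewrite /p' /q'; case: ifPn => [/bM bj|_]; last by rewrite normr0.
  by have [h1 h2 _] := pqP j; split; apply: le_trans bj.
by case: (fintype.split k) => j; have [] := bd (val j).
Qed.

End Chebyshev.

(** * Greedy sets and the exchange argument *)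

Section GreedySets.
Variables (R : realType) (K : numFieldType) (i : {rmorphism R -> K}).
Variables (re : K -> R).
Hypothesis iP : real_scalars i re.
Variables (X : completeNormedModType K).
Variables (e : nat -> X) (es : nat -> {linear X -> K^o}).
Hypothesis hB : schauder_basis e es.
Variable w : nat -> R.
Hypothesis w_gt0 : forall n, 0 < w n.

Local Notation N := (rnorm re).
Local Notation co := (coord es).

(** The value 1 at 0 keeps the phase unimodular everywhere without spoiling
    [z = i (N z) * phase z]. *)
Definition phase (z : K) : K := if z == 0 then 1 else z / i (N z).

Lemma phaseE z : z = i (N z) * phase z.
Proof.
rewrite /phase; case: eqP => [->|/eqP z0]; first by rewrite (rnorm0 iP) rmorph0 mul0r.
by rewrite mulrC divfK // scalar_rnorm // normr_eq0.
Qed.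

Lemma rnorm_phase z : N (phase z) = 1.
Proof.
rewrite /phase; case: eqP => [_|/eqP z0]; first exact: (rnorm1 iP).
rewrite (rnormM iP) (rnormV iP) (rnorm_scalar iP) ger0_norm ?(rnorm_ge0 iP) //.
by rewrite divff //; apply/eqP => /(rnorm0_eq0 iP) h; rewrite h eqxx in z0.
Qed.

Lemma rnormD_phase z d : 0 <= d -> N (z + i d * phase z) = N z + d.
Proof.
move=> d0; rewrite {1}[z]phaseE -mulrDl -rmorphD (rnormM iP) rnorm_phase mulr1.
by rewrite (rnorm_scalar iP) ger0_norm // addr_ge0 // (rnorm_ge0 iP).
Qed.

Lemma greedy_beforeE x a b : greedy_before es x a b <->
  N (co b x) < N (co a x) \/ (N (co b x) = N (co a x) /\ (a < b)%N).
Proof.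
change (greedy_before es x a b) with
  (`|co b x| < `|co a x| \/ (`|co b x| = `|co a x| /\ (a < b)%N)).
rewrite (lt_rnorm iP); split => -[h|[h1 h2]]; try by left.
  by right; split => //; rewrite /rnorm h1.
by right; split => //; rewrite -!(scalar_rnorm iP) h1.
Qed.

Lemma greedy_before_asym x a b :
  greedy_before es x a b -> ~ greedy_before es x b a.
Proof.
move=> [h1|[h1 h1']] [h2|[h2 h2']].
- by have := lt_trans h1 h2; rewrite ltxx.
- by rewrite h2 ltxx in h1.
- by rewrite h1 ltxx in h2.
- by have := ltn_trans h1' h2'; rewrite ltnn.
Qed.

(** Two distinct greedy sets of equal size each contain an index missing from the other, and these
    two indices would precede one another. *)
Lemma greedy_setE (A : {fset nat}) x :
  (forall a b, a \in A -> b \notin A -> greedy_before es x a b) ->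
  greedy_set es #|` A| x = A.
Proof.
move=> hA; apply: xget_unique; first by split.
move=> B [cB hB']; apply/eqP; rewrite eqEfcard cB leqnn andbT.
apply/fsubsetP => b bB; apply/negPn/negP => bA.
have : ~~ (A `<=` B)%fset.
  apply/negP => AB; have := fsubset_leqif_cards AB => -[_].
  rewrite cB eqxx => /esym/eqP AeB; by rewrite AeB bB in bA.
move/fsubsetPn => [a aA aB].
exact: (greedy_before_asym (hA _ _ aA bA) (hB' _ _ bB aB)).
Qed.

(** * Weights, approximation errors and a test vector *)

Lemma weight_ge0 (A : {fset nat}) : 0 <= weight w A.
Proof. by rewrite /weight sumr_ge0 // => j _; exact: ltW. Qed.

Lemma sigma_real (d : R) (x : X) : 0 <= d -> exists r : R,
  [/\ sigma e w d x = i r, 0 <= r,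
      forall A a, weight w A <= d -> r <= N (x - lincomb e A a) &
      forall M, (forall A a, weight w A <= d -> M <= N (x - lincomb e A a)) ->
        M <= r].
Proof.
move=> d0; have [||r [rE r0 r1 r2]] := @infimum_real _ _ _ _ iP
    [set r | exists (A : {fset nat}) (a : nat -> K),
       weight w A <= d /\ r = `|x - lincomb e A a|].
- exists `|x - lincomb e fset0 (fun=> 0)|, fset0, (fun=> 0).
  by rewrite /weight big_seq_fset0.
- by move=> _ [A [a [_ ->]]].
case: (iP) => i_le _ _; exists r; split => //.
  by move=> A a Ad; rewrite -i_le scalar_rnorm //; apply: r1; exists A, a.
by move=> M hM; apply: r2 => _ [A [a [Ad ->]]]; rewrite -(scalar_rnorm iP) i_le hM.
Qed.

Lemma semi_greedy_le (s : R) x y m (A : {fset nat}) a :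
  semi_greedy_constants e es w (i s) ->
  (0 < m)%N -> is_chebyshev_greedy_sum e es m x y ->
  weight w A <= weight w (greedy_set es m x) ->
  N (x - y) <= s * N (x - lincomb e A a).
Proof.
move=> [s0 sg] m0 cg wA; case: (iP) => i_le _ _.
have [r [rE r0 r1 _]] := sigma_real x (weight_ge0 (greedy_set es m x)).
have := sg _ _ _ m0 cg; rewrite rE -(scalar_rnorm iP) -rmorphM i_le => h.
apply: (le_trans h); rewrite ler_wpM2l ?r1 //.
by rewrite -i_le rmorph0 ltW.
Qed.

(** [e 0 + e 1] serves as test vector: after one greedy step its remainder is still nonzero. The tie
    between its two coefficients goes to the index 0. *)
Lemma greedy_set_pair : greedy_set es 1 (e 0 + e 1) = [fset 0%N]%fset.
Proof.
have := @greedy_setE [fset 0%N]%fset (e 0 + e 1); rewrite cardfs1; apply => a b; rewrite !inE => /eqP -> b0.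
apply/greedy_beforeE; rewrite !coordD !(coord_basis hB) eqxx (negbTE b0) /= add0r addr0.
have [->|_] := eqVneq b 1%N; first by right.
by left; rewrite (rnorm0 iP) (rnorm1 iP) ltr01.
Qed.

Lemma chebyshev_pair : exists2 y,
  is_chebyshev_greedy_sum e es 1 (e 0 + e 1) y & 0 < N (e 0 + e 1 - y).
Proof.
have [a ha] := chebyshev_exists iP hB [fset 0%N]%fset (e 0 + e 1).
exists (lincomb e [fset 0%N]%fset a).
  split; first by exists a; rewrite greedy_set_pair.
  by move=> b; rewrite greedy_set_pair (le_rnorm iP).
rewrite lt_def (rnorm_ge0 iP) andbT; apply/eqP => /(rnorm0_eq0 iP)/(congr1 (co 1)).
rewrite coordB coordD !(coord_basis hB) (coord_lincomb hB) coord0 inE /=.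
by move/eqP; rewrite add0r subr0 oner_eq0.
Qed.

(** A Chebyshev sum is itself an admissible competitor, so a nonzero Chebyshev error is at most [s]
    times itself. *)
Lemma semi_greedy_ge1 (s : R) : semi_greedy_constants e es w (i s) -> 1 <= s.
Proof.
move=> sg; have [y cy Ny] := chebyshev_pair.
have [[a ya] _] := cy.
have := @semi_greedy_le s _ _ 1 (greedy_set es 1 (e 0 + e 1)) a sg isT cy (lexx _).
by rewrite -ya ler_pMl.
Qed.

(* Perturbing [v] on [G] makes [G] the greedy set, without changing the coset of
   [v] modulo the span of [G]: the Chebyshev error does not see the size of the
   perturbation, which can be sent to 0. *)
Lemma greedy_exchange (s : R) (G H : {fset nat}) (v : X) (h : nat -> K) (t : R) :
  semi_greedy_constants e es w (i s) ->
  (forall j, j \in G -> j \notin H) -> weight w H <= weight w G ->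
  0 <= t -> (forall j, j \in G -> t <= N (co j v)) ->
  (forall j, j \notin G -> j \notin H -> N (co j v) <= t) ->
  (forall j, j \in H -> N (h j) <= t) ->
  exists y, [/\ forall j, j \notin G -> j \notin H -> co j y = co j v,
    forall j, j \in H -> co j y = h j & N y <= s * N v].
Proof.
move=> sg dGH wHG t0 vG voff hH.
have s1 := semi_greedy_ge1 sg.
have [G0|Gn0] := eqVneq G fset0.
  have H0 j : j \in H = false.
    apply/negP => jH; move: wHG; rewrite G0 {2}/weight big_seq_fset0 /weight.
    rewrite (big_fsetD1 j) //= leNgt => /negP; apply.
    by rewrite ltr_wpDr // weight_ge0.
  exists v; split => // [j|]; first by rewrite H0.
  by rewrite ler_peMl // (rnorm_ge0 iP).
pose u := lincomb e H (fun j => h j - co j v).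
pose p := lincomb e G (fun j => phase (co j v)).
have [a amin] := chebyshev_exists iP hB G (v + u).
exists (v + u - lincomb e G a); split.
- move=> j jG jH; rewrite coordB coordD !(coord_lincomb hB) (negbTE jG) (negbTE jH).
  by rewrite addr0 subr0.
- move=> j jH; rewrite coordB coordD !(coord_lincomb hB) jH.
  rewrite ifN; last by apply/negP => /dGH; rewrite jH.
  by rewrite subr0 addrC subrK.
apply/ler_addgt0Pr => d d0.
(* With [b = d / M] the perturbation adds at most [d] to the final estimate; the summand 1 avoids a
   division by zero. *)
pose M := s * N p + 1.
have M1 : 0 < M by rewrite ltr_wpDl // mulr_ge0 ?(rnorm_ge0 iP) // (le_trans ler01).
pose b := d / M; have b0 : 0 < b by rewrite divr_gt0.
pose x := v + u + i b *: p.
have gx : greedy_set es #|` G| x = G.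
  apply: greedy_setE => j k jG kG; apply/greedy_beforeE; left.
  rewrite !coordD !coordZ !(coord_lincomb hB) jG (negbTE kG).
  rewrite (ifN _ _ (dGH _ jG)) !addr0 mulr0 addr0 (rnormD_phase _ (ltW b0)).
  apply: (@le_lt_trans _ _ t).
    case: ifPn => kH; last by rewrite addr0 voff.
    by rewrite addrC subrK hH.
  by apply: (le_lt_trans (vG _ jG)); rewrite ltrDl.
have [a' a'min] := chebyshev_exists iP hB G x.
have cx : is_chebyshev_greedy_sum e es #|` G| x (lincomb e G a').
  split; first by exists a'; rewrite gx.
  by move=> c; rewrite gx (le_rnorm iP).
have := @semi_greedy_le s _ _ _ H (fun j => h j - co j v) sg _ cx.
rewrite gx cardfs_gt0 => /(_ Gn0 wHG).
(* The competitor supported on [H] undoes the change of coefficients there and leaves only the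
   perturbed [v]. *)
have -> : x - lincomb e H (fun j => h j - co j v) = v + i b *: p.
  by rewrite /x -/u addrAC addrK.
move=> h1; apply: (@le_trans _ _ (N (x - lincomb e G a'))).
  (* [x] and [v + u] differ by an element of the span of [G], so shifting the coefficients [a']
     makes the two errors equal. *)
  apply: (le_trans (amin (fun j => a' j - i b * phase (co j v)))).
  rewrite le_eqVlt; apply/orP; left; apply/eqP; congr (N _).
  apply: (coord_ext hB) => j; rewrite /x !(coordD, coordN, coordZ) !(coord_lincomb hB).
  by case: (j \in G); ring.
apply: (le_trans h1); apply: (@le_trans _ _ (s * (N v + b * N p))).
  rewrite ler_wpM2l ?(le_trans ler01) //; apply: (le_trans (ler_rnormD iP _ _)).
  by rewrite (rnormZ iP) (rnorm_scalar iP) ger0_norm // ltW.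
rewrite mulrDr lerD2l mulrCA /b mulrAC ler_pdivrMr //.
by rewrite ler_wpM2l ?(ltW d0) // /M lerDl ler01.
Qed.

End GreedySets.

(** * Semi-greedy bases are quasi-greedy *)

Lemma nat_crossing (P : pred nat) n : P 0%N -> ~~ P n ->
  exists q, P q && ~~ P q.+1.
Proof.
elim: n => [->//|n IH P0 Pn]; case: (boolP (P n)) => Pn'; last exact: IH.
by exists n; rewrite Pn' Pn.
Qed.

Lemma seq_argmin (R : realType) (f : nat -> R) (x : nat) (t : seq nat) :
  exists2 j, j \in x :: t & forall k, k \in x :: t -> f j <= f k.
Proof.
elim: t x => [|y t IH] x.
  by exists x => [|k]; rewrite inE // => /eqP ->.
have [j jt jmin] := IH y.
have [fx|fx] := leP (f x) (f j).
  exists x => [|k]; rewrite inE ?eqxx // => /predU1P[->//|kt].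
  exact: le_trans fx (jmin _ kt).
exists j => [|k]; rewrite inE ?jt ?orbT // => /predU1P[->|/jmin//].
exact: ltW.
Qed.

Lemma fset_argmin (R : realType) (f : nat -> R) (A : {fset nat}) :
  A != fset0 -> exists2 j, j \in A & forall k, k \in A -> f j <= f k.
Proof.
move=> /fset0Pn[a aA].
case E : (A : seq nat) => [|x t]; first by move: aA; rewrite -[a \in A]/(a \in (A : seq nat)) E.
have [j jA jmin] := seq_argmin f x t.
by exists j => [|k]; rewrite -[_ \in A]/(_ \in (A : seq nat)) E //; exact: jmin.
Qed.

Section SemiGreedy.
Variables (R : realType) (K : numFieldType) (i : {rmorphism R -> K}).
Variables (re : K -> R).
Hypothesis iP : real_scalars i re.
Variables (X : completeNormedModType K).
Variables (e : nat -> X) (es : nat -> {linear X -> K^o}).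
Hypothesis hB : schauder_basis e es.
Variable w : nat -> R.
Hypothesis w_gt0 : forall n, 0 < w n.

Local Notation N := (rnorm re).
Local Notation co := (coord es).
Local Notation P := (partial_sum e es).

Variables c Kb s : R.
Hypothesis he : forall n, N (e n) <= c.
Hypothesis hc : forall n x, N (co n x) <= c * N x.
Hypothesis hP : forall m x, N (P m x) <= Kb * N x.
Hypothesis sg : semi_greedy_constants e es w (i s).

Let s1 : 1 <= s. Proof. exact: (semi_greedy_ge1 iP hB w_gt0 sg). Qed.
Let s0 : 0 <= s. Proof. exact: le_trans s1. Qed.

(** [1 = co 0 (e 0)] is at most [c * N (e 0)], hence at most [c * c]. *)
Lemma coord_constant_ge1 : 1 <= c.
Proof.
have c0 : 0 <= c by apply: le_trans (he 0); exact: (rnorm_ge0 iP).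
have : 1 <= c * c.
  apply: (@le_trans _ _ (N (co 0 (e 0)))).
    by rewrite (coord_basis hB) eqxx (rnorm1 iP).
  by apply: (le_trans (hc _ _)); rewrite ler_wpM2l.
by move=> cc; rewrite leNgt; apply/negP => c1; nra.
Qed.

Lemma basis_vector_gt0 n : 0 < N (e n).
Proof.
have c0 := lt_le_trans ltr01 coord_constant_ge1.
have := hc n (e n); rewrite (coord_basis hB) eqxx (rnorm1 iP) => h.
by rewrite -(pmulr_rgt0 _ c0) (lt_le_trans ltr01).
Qed.

Lemma basis_constant_ge1 : 1 <= Kb.
Proof.
have := hP 1 (e 0); have -> : P 1 (e 0) = e 0.
  apply: (coord_ext hB) => j; rewrite (coord_partial_sum hB) (coord_basis hB).
  by case: j.
by rewrite ler_pMl // basis_vector_gt0.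
Qed.

Let K1 := basis_constant_ge1.
Let K0 : 0 <= Kb. Proof. exact: le_trans K1. Qed.

Lemma tail_bound m x : N (x - P m x) <= (1 + Kb) * N x.
Proof.
by apply: (le_trans (ler_rnormBD iP _ _)); rewrite mulrDl mul1r lerD2l hP.
Qed.

(** The uncontrolled coefficients on [G] get the name [g], so that one formula describes all
    coordinates of [y] and the later verifications become case analyses. *)
Lemma exchange (G H : {fset nat}) (v : X) (h : nat -> K) (t : R) :
  (forall j, j \in G -> j \notin H) -> weight w H <= weight w G ->
  0 <= t -> (forall j, j \in G -> t <= N (co j v)) ->
  (forall j, j \notin G -> j \notin H -> N (co j v) <= t) ->
  (forall j, j \in H -> N (h j) <= t) ->
  exists (y : X) (g : nat -> K),
    (forall j, co j y = if j \in H then h j else if j \in G then g j else co j v)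
    /\ N y <= s * N v.
Proof.
move=> h1 h2 h3 h4 h5 h6.
have [y [y1 y2 Ny]] := greedy_exchange iP hB w_gt0 sg h1 h2 h3 h4 h5 h6.
exists y, (fun j => co j y); split => // j.
by case: ifP => [/y2//|/negbT jH]; case: ifP => // /negbT jG; exact: y1.
Qed.

Lemma semi_greedy_quasi_greedy (x : X) m :
  N (x - greedy_sum e es m x) <= (1 + 2 * Kb) * s * N x.
Proof.
have Nx : 0 <= N x by exact: (rnorm_ge0 iP).
have bnd : N x <= (1 + 2 * Kb) * s * N x.
  have Ks : 0 <= Kb * s by rewrite mulr_ge0.
  by rewrite ler_peMl // mulrDl; move: s1 => ?; nra.
rewrite /greedy_sum; set A := greedy_set es m x.
have [A0|An0] := eqVneq A fset0.
  by rewrite A0 /lincomb big_seq_fset0 subr0.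
(* The default value of [xget] is [fset0], so a nonempty [A] has the greedy property. *)
have gA : forall a b, a \in A -> b \notin A -> greedy_before es x a b.
  have : A <> fset0 by exact/eqP.
  by rewrite /A /greedy_set; case: xgetP => [_ -> []|].
have [j0 j0A j0min] := fset_argmin (fun j => N (co j x)) An0.
have j0max j : j \notin A -> N (co j x) <= N (co j0 x).
  by move=> /(gA _ _ j0A)/(greedy_beforeE iP)[/ltW|[-> _]].
pose L q := [fset j in A | (j < q)%N]%fset.
pose U q := [fset j in A | ~~ (j < q)%N]%fset.
have wA q : weight w A = weight w (L q) + weight w (U q).
  by rewrite /weight (big_fsetID _ (fun j => (j < q)%N)).
have [||q /andP[q1 q2]] := @nat_crossing (fun q => weight w (L q) <= weight w (U q))
    (\max_(k <- A) k).+1.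
- apply: (@le_trans _ _ 0); last exact: (weight_ge0 w_gt0).
  by rewrite /weight big_seq big1 // => j; rewrite !inE ltn0 andbF.
- rewrite -ltNge; have -> : U (\max_(k <- A) k).+1 = fset0.
    apply/fsetP => j; rewrite !inE; case jA: (j \in A) => //=.
    by apply/negbTE; rewrite negbK ltnS; exact: leq_bigmax_seq.
  rewrite {1}/weight big_seq_fset0 /weight (big_fsetD1 j0) /=; last first.
    by rewrite !inE j0A ltnS /=; exact: leq_bigmax_seq.
  by rewrite ltr_wpDr // (weight_ge0 w_gt0).
(* [q] is a weighted median of [A], shared by both exchanges below. *)
move: q2; rewrite -ltNge => q2.
have qA : q \in A.
  apply/negPn/negP => qA; have LL : L q.+1 = L q.
    apply/fsetP => j; rewrite !inE ltnS leq_eqVlt; case: eqP => // -> /=.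
    by rewrite (negbTE qA).
  have := wA q; have := wA q.+1; rewrite LL in q2 *; lra.
(* [y] vanishes on the part of [A] left of [q]; control is lost only from [q] on, which [P q] cuts
   off. *)
have [||||||y [gy [yE Ny]]] := @exchange (U q) (L q) x (fun=> 0) (N (co j0 x)).
- by move=> j; rewrite !inE => /andP[_ /negbTE ->]; rewrite andbF.
- exact: q1.
- exact: (rnorm_ge0 iP).
- by move=> j; rewrite !inE => /andP[/j0min].
- move=> j; rewrite !inE; case jA: (j \in A) => /=; last by rewrite j0max ?jA.
  by move=> /negPn ->.
- by move=> j _; rewrite (rnorm0 iP) (rnorm_ge0 iP).
(* Symmetrically, [z] vanishes on the part of [A] right of [q], and control is lost only up to
   [q]. *)
have [||||||z [gz [zE Nz]]] := @exchange (L q.+1) (U q.+1) x (fun=> 0) (N (co j0 x)).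
- by move=> j; rewrite !inE => /andP[_ ->]; rewrite andbF.
- exact: ltW.
- exact: (rnorm_ge0 iP).
- by move=> j; rewrite !inE => /andP[/j0min].
- move=> j; rewrite !inE; case jA: (j \in A) => /=; last by rewrite j0max ?jA.
  by move=> /negbTE ->.
- by move=> j _; rewrite (rnorm0 iP) (rnorm_ge0 iP).
(* The index [q] is dropped by both truncations, as it must be since it lies in [A]. *)
have -> : x - lincomb e A (fun n => es n x) = P q y + (z - P q.+1 z).
  apply: (coord_ext hB) => j.
  rewrite !(coordD, coordN) !(coord_partial_sum hB) (coord_lincomb hB) yE zE !inE ltnS.
  rewrite -[es j x]/(co j x); case: (ltngtP j q) => [jq|jq|->]; last first.
  - by rewrite qA /= !subrr addr0.
  - by case: (j \in A); rewrite /= ?subrr ?subr0 ?add0r.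
  - by case: (j \in A); rewrite /= ?subrr ?subr0 ?addr0.
apply: (le_trans (ler_rnormD iP _ _)).
have h1 := le_trans (hP q y) (ler_wpM2l K0 Ny).
have h2 := le_trans (tail_bound q.+1 z) (ler_wpM2l (addr_ge0 ler01 K0) Nz).
by apply: (le_trans (lerD h1 h2)); rewrite -subr_ge0; nra.
Qed.

End SemiGreedy.

(** * Semi-greedy bases are super-democratic *)

(* The ways in which the constant of the theorem, [k ((1 + k) s + c^2)], is shared
   among the pieces of [1_A]; here [k] is the basis constant and [x] is the
   semi-greedy constant [s] times the norm of [1_B]. *)
Section Budget.
Variables (R : realFieldType) (k s c x : R).
Hypotheses (k1 : 1 <= k) (s1 : 1 <= s) (c1 : 1 <= c) (x0 : 0 <= x).

Let k0 : 0 <= k. Proof. exact: le_trans k1. Qed.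
Let s0 : 0 <= s. Proof. exact: le_trans s1. Qed.
Let c21 : 1 <= c ^+ 2. Proof. by rewrite exprn_ege1. Qed.
Let kx : 0 <= k * x. Proof. exact: mulr_ge0. Qed.
Let sx : x <= s * x. Proof. by rewrite ler_peMl. Qed.
Let sx0 : 0 <= s * x. Proof. exact: mulr_ge0. Qed.
Let ksx : s * x <= k * (s * x). Proof. by rewrite ler_peMl. Qed.
Let kksx : k * (s * x) <= k * (k * (s * x)).
Proof. by rewrite ler_peMl // mulr_ge0. Qed.
Let kcx : k * x <= c ^+ 2 * (k * x). Proof. by rewrite ler_peMl. Qed.

Lemma budget1 u v : u <= k * x -> v <= (1 + k) * (s * (k * x)) ->
  u + v <= k * ((1 + k) * s + c ^+ 2) * x.
Proof.
move=> hu hv; have -> : k * ((1 + k) * s + c ^+ 2) * x =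
  c ^+ 2 * (k * x) + (1 + k) * (s * (k * x)) by ring.
by have := kcx; lra.
Qed.

Lemma budget2 u v : u <= k * (s * x) -> v <= (1 + k) * x ->
  u + v <= k * ((1 + k) * s + c ^+ 2) * x.
Proof.
move=> hu hv; have -> : k * ((1 + k) * s + c ^+ 2) * x =
  c ^+ 2 * (k * x) + k * (s * x) + k * (k * (s * x)) by ring.
by have := kcx; have := sx; have := ksx; have := kksx; lra.
Qed.

(** The factor [1 - (c * x)^-1] saves [k / c], and this makes room for the stray term [c]: the gap
    between the two sides is [c^-1] times a sum of three nonnegative terms. *)
Lemma budget3 u v z : 1 <= c * x -> u <= k * (s * x) ->
  v <= x + (1 - (c * x)^-1) * (k * x) -> z <= c ->
  u + v + z <= k * ((1 + k) * s + c ^+ 2) * x.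
Proof.
move=> cx hu hv hz; pose y := c * x; pose m := c^-1.
have c0 : 0 < c by exact: lt_le_trans c1.
have x0' : 0 < x by rewrite -(pmulr_rgt0 _ c0) (lt_le_trans ltr01).
have m0 : 0 <= m by rewrite invr_ge0 ltW.
have h1 : (c * x)^-1 * (k * x) = m * k.
  by rewrite /m; field; rewrite !gt_eqF.
have y1 : 1 <= y by [].
have ks1 : 0 <= k ^+ 2 * s - 1.
  by rewrite subr_ge0 -[1]mulr1 ler_pM // exprn_ege1.
have ky1 : 0 <= k * y - 1 by rewrite subr_ge0 -[1]mulr1 ler_pM.
have h2 : 0 <= m * ((k ^+ 2 * s - 1) * y + (k - 1) + (c ^+ 2 - 1) * (k * y - 1)).
  rewrite mulr_ge0 // addr_ge0 //; last by rewrite mulr_ge0 // subr_ge0.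
  by rewrite addr_ge0 ?subr_ge0 // mulr_ge0 // (le_trans ler01).
have h3 : k * ((1 + k) * s + c ^+ 2) * x - (k * (s * x) + (x + k * x - m * k) + c)
    = m * ((k ^+ 2 * s - 1) * y + (k - 1) + (c ^+ 2 - 1) * (k * y - 1)).
  by rewrite /m /y; field; rewrite gt_eqF.
rewrite mulrBl mul1r h1 in hv; rewrite -h3 in h2; lra.
Qed.

End Budget.

Section SuperDemocracy.
Variables (R : realType) (K : numFieldType) (i : {rmorphism R -> K}).
Variables (re : K -> R).
Hypothesis iP : real_scalars i re.
Variables (X : completeNormedModType K).
Variables (e : nat -> X) (es : nat -> {linear X -> K^o}).
Hypothesis hB : schauder_basis e es.
Variable w : nat -> R.
Hypothesis w_gt0 : forall n, 0 < w n.

Local Notation N := (rnorm re).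
Local Notation co := (coord es).
Local Notation P := (partial_sum e es).

Variables c Kb s : R.
Hypothesis he : forall n, N (e n) <= c.
Hypothesis hc : forall n x, N (co n x) <= c * N x.
Hypothesis hP : forall m x, N (P m x) <= Kb * N x.
Hypothesis sg : semi_greedy_constants e es w (i s).

Let s1 : 1 <= s. Proof. exact: (semi_greedy_ge1 iP hB w_gt0 sg). Qed.
Let s0 : 0 <= s. Proof. exact: le_trans s1. Qed.
Let K1 : 1 <= Kb. Proof. exact: (basis_constant_ge1 iP hB he hc hP). Qed.
Let K0 : 0 <= Kb. Proof. exact: le_trans K1. Qed.
Let c1 : 1 <= c. Proof. exact: (coord_constant_ge1 iP hB he hc). Qed.
Let exch := exchange iP hB w_gt0 sg.

Variables (A B : {fset nat}) (eps eps' : nat -> K).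
Hypothesis wAB : weight w A <= weight w B.
Hypotheses (eps1 : forall n, N (eps n) = 1) (eps'1 : forall n, N (eps' n) = 1).

(** * Cutting the sets [A] and [B] at an index *)

Section Cut.
Variable q : nat.

(* The four booleans say whether [j] lies to the left of [q], to the right of [q],
   in [A] and in [B]; the cut index [q] itself is neither left nor right. *)
Definition part (f : bool -> bool -> bool -> bool -> bool) : {fset nat} :=
  [fset j in (A `|` B)%fset | f (j < q)%N (q < j)%N (j \in A) (j \in B)]%fset.

Local Notation W f := (weight w (part f)).

Lemma in_part f j : j \in part f =
  ((j \in A) || (j \in B)) && f (j < q)%N (q < j)%N (j \in A) (j \in B).
Proof. by rewrite !inE. Qed.

(** There are seven atoms: on each side of the cut the indices in [A] only, in both sets and in [B]
    only, and then the cut index. *)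
Lemma weight_partE f : W f =
  (if f true false true false then W (fun l r a b => [&& l, a & ~~ b]) else 0) +
  (if f true false true true then W (fun l r a b => [&& l, a & b]) else 0) +
  (if f true false false true then W (fun l r a b => [&& l, ~~ a & b]) else 0) +
  (if f false true true false then W (fun l r a b => [&& r, a & ~~ b]) else 0) +
  (if f false true true true then W (fun l r a b => [&& r, a & b]) else 0) +
  (if f false true false true then W (fun l r a b => [&& r, ~~ a & b]) else 0) +
  (if f false false (q \in A) (q \in B)
   then W (fun l r a b => ~~ l && ~~ r) else 0).
Proof.
have E (b : bool) g : (if b then W g else 0) = \sum_(j <- (A `|` B)%fset)
    if b && g (j < q)%N (q < j)%N (j \in A) (j \in B) then w j else 0.
  by case: b; rewrite ?big1_eq //= -big_mkcond big_fset_condE.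
rewrite !E -!big_split /= /weight -big_fset_condE big_mkcond; apply: eq_big_seq => j.
rewrite in_fsetU; case: (ltngtP j q) => [_|_|->].
- by case: (j \in A); case: (j \in B); rewrite //= ?andbT !andbF !(add0r, addr0).
- by case: (j \in A); case: (j \in B); rewrite //= ?andbT !andbF !(add0r, addr0).
- by rewrite /= !andbF andbT !(add0r, addr0).
Qed.

(** With the atoms abstracted to nonnegative reals, comparisons between weights of parts become
    linear inequalities within reach of [lra]. *)
Lemma weight_atoms : exists a1 i1 b1 a2 i2 b2 z : R,
  [/\ [/\ 0 <= a1, 0 <= i1, 0 <= b1 & 0 <= a2], [/\ 0 <= i2, 0 <= b2 & 0 <= z] &
  forall f, W f =
  (if f true false true false then a1 else 0) +
  (if f true false true true then i1 else 0) +
  (if f true false false true then b1 else 0) +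
  (if f false true true false then a2 else 0) +
  (if f false true true true then i2 else 0) +
  (if f false true false true then b2 else 0) +
  (if f false false (q \in A) (q \in B) then z else 0)].
Proof.
by do 7 eexists; split; last exact: weight_partE; split; exact: (weight_ge0 w_gt0).
Qed.

Lemma weight_partT :
  weight w A = W (fun l r a b => a) /\ weight w B = W (fun l r a b => b).
Proof.
by split; congr (weight w _); apply/fsetP => j; rewrite in_part;
  case: (j \in A); case: (j \in B).
Qed.

(** * Exchanges across the crossing index *)

Hypothesis cut_left : W (fun l r a b => l && a) <= W (fun l r a b => ~~ l && b).
Hypothesis cut_right : W (fun l r a b => r && b) < W (fun l r a b => ~~ r && a).

Let beta := N (lincomb e B eps').
(** Here [sigma] is the bound after one exchange started from [1_B]; it shadows the approximation
    error of the same name. *)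
Let sigma := s * beta.

Let beta0 : 0 <= beta. Proof. exact: (rnorm_ge0 iP). Qed.
Let sigma0 : 0 <= sigma. Proof. exact: mulr_ge0. Qed.

Let piece (f : bool -> bool -> bool -> bool -> bool) := lincomb e (part f) eps.

(** On [B] all coefficients of the rotated [1_B] have modulus 1, so any part of [B] may play the
    greedy set at height 1. The alternative [l && r] is an impossible position; allowing it lets
    disjointness be checked on booleans alone. *)
Lemma exchange_base (om : K) (f g : bool -> bool -> bool -> bool -> bool)
    (h : nat -> K) : N om = 1 ->
  (forall l r a b, f l r a b -> ~~ g l r a b || (l && r)) ->
  (forall l r a b, f l r a b -> b) ->
  W g <= W f -> (forall j, N (h j) <= 1) ->
  exists (y : X) (k : nat -> K), (forall j, co j y =
    if j \in part g then h j else if j \in part f then k j else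
    if j \in B then om * eps' j else 0) /\ N y <= sigma.
Proof.
move=> om1 fg fb wfg h1.
have vE j : co j (om *: lincomb e B eps') = if j \in B then om * eps' j else 0.
  by rewrite coordZ (coord_lincomb hB); case: ifP; rewrite ?mulr0.
have [||||||y [k [yE Ny]]] :=
    @exch (part f) (part g) (om *: lincomb e B eps') h 1.
- move=> j; rewrite !in_part => /andP[_ /fg]; case: (ltngtP j q) => _;
    by rewrite /= orbF => /negbTE ->; rewrite andbF.
- exact: wfg.
- exact: ler01.
- move=> j; rewrite in_part vE => /andP[_ /fb ->].
  by rewrite (rnormM iP) om1 eps'1 mulr1.
- move=> j _ _; rewrite vE; case: ifP => _; last by rewrite (rnorm0 iP) ler01.
  by rewrite (rnormM iP) om1 eps'1 mulr1.
- by move=> j _; exact: h1.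
exists y, k; split => [j|]; first by rewrite yE vE.
by apply: (le_trans Ny); rewrite (rnormZ iP) om1 mul1r.
Qed.

(** This lemma and the next three read off a piece of [1_A] from a vector agreeing with it on one
    side: a partial sum costs [Kb], a tail [1 + Kb]. The suffix [_eq] marks the variants including
    the cut index. *)
Lemma left_piece z :
  (forall j, (j < q)%N -> co j z = if j \in A then eps j else 0) ->
  N (piece (fun l r a b => l && a)) <= Kb * N z.
Proof.
move=> zE; suff -> : piece (fun l r a b => l && a) = P q z by exact: hP.
apply: (coord_ext hB) => j; rewrite (coord_lincomb hB) (coord_partial_sum hB) in_part.
case: ltnP => [/zE ->|_]; last by rewrite andbF.
by case: (j \in A); case: (j \in B).
Qed.

Lemma left_piece_eq z :
  (forall j, (j <= q)%N -> co j z = if j \in A then eps j else 0) ->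
  N (piece (fun l r a b => ~~ r && a)) <= Kb * N z.
Proof.
move=> zE; suff -> : piece (fun l r a b => ~~ r && a) = P q.+1 z by exact: hP.
apply: (coord_ext hB) => j; rewrite (coord_lincomb hB) (coord_partial_sum hB) in_part.
rewrite ltnS -leqNgt; case: leqP => [/zE ->|_]; last by rewrite andbF.
by case: (j \in A); case: (j \in B).
Qed.

Lemma right_piece z :
  (forall j, (q < j)%N -> co j z = if j \in A then eps j else 0) ->
  N (piece (fun l r a b => r && a)) <= (1 + Kb) * N z.
Proof.
move=> zE; suff -> : piece (fun l r a b => r && a) = z - P q.+1 z by exact: (tail_bound iP).
apply: (coord_ext hB) => j.
rewrite coordB (coord_lincomb hB) (coord_partial_sum hB) in_part ltnS.
case: leqP => [_|/zE ->]; first by rewrite andbF subrr.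
by rewrite subr0; case: (j \in A); case: (j \in B).
Qed.

Lemma right_piece_eq z :
  (forall j, (q <= j)%N -> co j z = if j \in A then eps j else 0) ->
  N (piece (fun l r a b => ~~ l && a)) <= (1 + Kb) * N z.
Proof.
move=> zE; suff -> : piece (fun l r a b => ~~ l && a) = z - P q z by exact: (tail_bound iP).
apply: (coord_ext hB) => j.
rewrite coordB (coord_lincomb hB) (coord_partial_sum hB) in_part.
case: ltnP => [_|/zE ->]; first by rewrite andbF subrr.
by rewrite subr0; case: (j \in A); case: (j \in B).
Qed.

Lemma piece_split1 : lincomb e A eps =
  piece (fun l r a b => l && a) + piece (fun l r a b => ~~ l && a).
Proof.
apply: (coord_ext hB) => j; rewrite coordD !(coord_lincomb hB) !in_part.
by case: (j < q)%N; case: (j \in A); case: (j \in B); rewrite /= ?addr0 ?add0r.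
Qed.

Lemma piece_split2 : lincomb e A eps =
  piece (fun l r a b => ~~ r && a) + piece (fun l r a b => r && a).
Proof.
apply: (coord_ext hB) => j; rewrite coordD !(coord_lincomb hB) !in_part.
by case: (q < j)%N; case: (j \in A); case: (j \in B); rewrite /= ?addr0 ?add0r.
Qed.

Lemma rnorm_half (x y : X) M : N x <= M -> N y <= M ->
  N (2^-1 *: (x + y)) <= M.
Proof.
move=> xM yM; have -> : (2^-1 : K) = i 2^-1 by rewrite fmorphV rmorph_nat.
rewrite (rnormZ iP) (rnorm_scalar iP) ger0_norm //.
by have := ler_rnormD iP x y; lra.
Qed.

Lemma halfD (x : K) : 2^-1 * (x + x) = x.
Proof. by field. Qed.

Let eps_le1 j : N (eps j) <= 1. Proof. by rewrite eps1. Qed.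

Let rnormN1 : N (-1 : K) = 1. Proof. by rewrite rnormN (rnorm1 iP). Qed.

(** Left of [q], the exchanges started from [1_B] and [-1_B] both carry [eps] on [A] and have
    opposite coefficients on [B] outside [A]; their average keeps the former and erases the
    latter. *)
Lemma left_bound : N (piece (fun l r a b => l && a)) <= Kb * sigma.
Proof.
have [||y [k [yE Ny]]] := @exchange_base 1 (fun l r a b => ~~ l && b)
  (fun l r a b => l && a) eps (rnorm1 iP) _ _ cut_left eps_le1.
- by do 4 case.
- by do 4 case.
have [||z [k' [zE Nz]]] := @exchange_base (-1) (fun l r a b => ~~ l && b)
  (fun l r a b => l && a) eps rnormN1 _ _ cut_left eps_le1.
- by do 4 case.
- by do 4 case.
have := rnorm_half Ny Nz; move/(ler_wpM2l K0); apply: le_trans.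
apply: left_piece => j jq; rewrite coordZ coordD yE zE !in_part jq /=.
case: (j \in A); case: (j \in B); rewrite /= ?halfD //.
by rewrite mul1r mulN1r subrr mulr0.
Qed.

Lemma right_bound : N (piece (fun l r a b => r && a)) <= (1 + Kb) * sigma.
Proof.
(* Subtracting [cut_right] from [w(A) <= w(B)] gives the mirror image of [cut_left]. *)
have cr : W (fun l r a b => r && a) <= W (fun l r a b => ~~ r && b).
  move: wAB cut_right; have [-> ->] := weight_partT.
  have [a1 [i1 [b1 [a2 [i2 [b2 [z [_ _ E]]]]]]]] := weight_atoms.
  by rewrite !E /=; case: (q \in A); case: (q \in B); lra.
have [||y [k [yE Ny]]] := @exchange_base 1 (fun l r a b => ~~ r && b)
  (fun l r a b => r && a) eps (rnorm1 iP) _ _ cr eps_le1.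
- by do 4 case.
- by do 4 case.
have [||z [k' [zE Nz]]] := @exchange_base (-1) (fun l r a b => ~~ r && b)
  (fun l r a b => r && a) eps rnormN1 _ _ cr eps_le1.
- by do 4 case.
- by do 4 case.
have := rnorm_half Ny Nz; move/(ler_wpM2l (addr_ge0 ler01 K0)); apply: le_trans.
apply: right_piece => j jq; rewrite coordZ coordD yE zE !in_part jq /=.
case: (j \in A); case: (j \in B); rewrite /= ?halfD //.
by rewrite mul1r mulN1r subrr mulr0.
Qed.

Lemma weight_subset (C D : {fset nat}) :
  (forall j, j \in C -> j \in D) -> weight w C <= weight w D.
Proof.
move=> CD; have CE : [fset j in D | j \in C]%fset = C.
  by apply/fsetP => j; rewrite !inE; case: (boolP (j \in C)) => [/CD ->|]; rewrite ?andbF.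
rewrite {2}/weight (big_fsetID _ (mem C)) /= CE lerDl.
exact: (weight_ge0 w_gt0).
Qed.

Lemma cut_not_mem : q \notin A ->
  N (lincomb e A eps) <= Kb * ((1 + Kb) * s + c ^+ 2) * sigma.
Proof.
move=> qA; rewrite piece_split1.
have -> : piece (fun l r a b => ~~ l && a) = piece (fun l r a b => r && a).
  congr (lincomb e _ eps); apply/fsetP => j; rewrite !in_part.
  by case: (ltngtP j q) => // ->; rewrite (negbTE qA) /= !andbF.
apply: (le_trans (ler_rnormD iP _ _)).
apply: (budget1 K1 c1 sigma0 left_bound); apply: (le_trans right_bound).
rewrite ler_wpM2l ?addr_ge0 // mulrCA.
by rewrite -[X in X <= _]mul1r ler_pM // -[X in X <= _]mul1r ler_pM.
Qed.

(** The cut index joins the right half; the budget allows two exchanges with a partial sum in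
    between. *)
Let cut_from_right z : N z <= s * (Kb * sigma) ->
  (forall j, (q <= j)%N -> co j z = if j \in A then eps j else 0) ->
  N (lincomb e A eps) <= Kb * ((1 + Kb) * s + c ^+ 2) * sigma.
Proof.
move=> Nz zE; rewrite piece_split1; apply: (le_trans (ler_rnormD iP _ _)).
apply: (budget1 K1 c1 sigma0 left_bound).
apply: (le_trans (right_piece_eq zE)).
by rewrite ler_wpM2l ?addr_ge0.
Qed.

(** The cut index joins the left half; the budget allows two exchanges in a row. *)
Let cut_from_left z : N z <= s * sigma ->
  (forall j, (j <= q)%N -> co j z = if j \in A then eps j else 0) ->
  N (lincomb e A eps) <= Kb * ((1 + Kb) * s + c ^+ 2) * sigma.
Proof.
move=> Nz zE; rewrite piece_split2; apply: (le_trans (ler_rnormD iP _ _)).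
apply: (budget2 K1 s1 c1 sigma0 _ right_bound).
by apply: (le_trans (left_piece_eq zE)); rewrite ler_wpM2l.
Qed.

(** Rotating [1_B] by [om] gives the coefficient at [q] its final value from the start, so [q] takes
    part in no exchange. *)
Lemma cut_mem_both : q \in A -> q \in B ->
  N (lincomb e A eps) <= Kb * ((1 + Kb) * s + c ^+ 2) * sigma.
Proof.
move=> qA qB; pose om := eps q / eps' q.
have om1 : N om = 1 by rewrite (rnormM iP) (rnormV iP) eps1 eps'1 divr1.
have omq : om * eps' q = eps q.
  rewrite divfK //; apply/eqP => h; have := eps'1 q.
  by rewrite h (rnorm0 iP) => /esym/eqP; rewrite oner_eq0.
have omE j : N (om * eps' j) = 1 by rewrite (rnormM iP) om1 eps'1 mulr1.
(* If [B] left of [q] is heavy enough, one exchange against it installs [A] on the right. The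
   initial partial sum removes the elements of [B] there. *)
have [h1|h1] := leP (W (fun l r a b => r && a)) (W (fun l r a b => l && b)).
  pose v := P q.+1 (om *: lincomb e B eps').
  have vE j : co j v = if (j < q.+1)%N then if j \in B then om * eps' j else 0 else 0.
    rewrite (coord_partial_sum hB) coordZ (coord_lincomb hB).
    by case: (j < _)%N; case: (j \in B); rewrite ?mulr0.
  have [||||||z [k [zE Nz]]] := @exch
      (part (fun l r a b => l && b)) (part (fun l r a b => r && a)) v eps 1.
  - move=> j; rewrite !in_part; case: (ltngtP j q) => _;
      by case: (j \in A); case: (j \in B).
  - exact: h1.
  - exact: ler01.
  - move=> j; rewrite in_part vE ltnS; case: (ltngtP j q) => _ /=;
      rewrite ?andbF //.
    by case: (j \in B); rewrite ?andbF // omE.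
  - move=> j _ _; rewrite vE; case: ifP => _; last by rewrite (rnorm0 iP) ler01.
    by case: ifP => _; rewrite ?omE ?(rnorm0 iP) ?ler01.
  - by move=> j _; exact: eps_le1.
  apply: (@cut_from_right z).
    apply: (le_trans Nz); rewrite ler_wpM2l //; apply: (le_trans (hP _ _)).
    rewrite (rnormZ iP) om1 mul1r ler_wpM2l // /sigma ler_peMl //.
  move=> j; rewrite zE vE !in_part ltnS; case: (ltngtP j q) => [//|_|-> _] /=.
    by case: (j \in A); case: (j \in B).
  by rewrite qA qB omq.
have wAB' : W (fun l r a b => l && a) <= W (fun l r a b => r && b).
  move: h1 cut_left cut_right wAB; have [-> ->] := weight_partT.
  have [a1 [i1 [b1 [a2 [i2 [b2 [z [_ _ E]]]]]]]] := weight_atoms.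
  by rewrite !E qA qB /=; lra.
(* Otherwise a first exchange installs [A] on the left, enlarging the set of unimodular coefficients
   there to the left part of the union; this set is then exchanged against [A] on the right. *)
have [h2|h2] := leP (W (fun l r a b => r && a)) (W (fun l r a b => l && (a || b))).
  have [||y [k [yE Ny]]] := @exchange_base om (fun l r a b => r && b)
    (fun l r a b => l && a) eps om1 _ _ wAB' eps_le1.
  - by case=> -[] [] [].
  - by case=> -[] [] [].
  pose v := P q.+1 y.
  have vE j : co j v = if (j < q)%N then if j \in A then eps j else
      if j \in B then om * eps' j else 0 else if j == q then eps q else 0.
    rewrite (coord_partial_sum hB) yE !in_part ltnS; case: (ltngtP j q) => // [_|->].
      by case: (j \in A); case: (j \in B).
    by rewrite qA qB omq.
  have [||||||z [k' [zE Nz]]] := @exch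
      (part (fun l r a b => l && (a || b))) (part (fun l r a b => r && a)) v eps 1.
  - move=> j; rewrite !in_part; case: (ltngtP j q) => _;
      by case: (j \in A); case: (j \in B).
  - exact: h2.
  - exact: ler01.
  - move=> j; rewrite in_part vE; case: (ltngtP j q) => _ /=; rewrite ?andbF //.
    by case: (j \in A); case: (j \in B); rewrite //= ?eps1 ?omE.
  - move=> j _ _; rewrite vE; do ?[case: ifP => _]; by rewrite ?omE ?(rnorm0 iP) ?ler01.
  - by move=> j _; exact: eps_le1.
  apply: (@cut_from_right z).
    apply: (le_trans Nz); rewrite ler_wpM2l //; apply: (le_trans (hP _ _)).
    by rewrite ler_wpM2l.
  move=> j; rewrite zE vE !in_part; case: (ltngtP j q) => [//|_|-> _] /=.
    by case: (j \in A); case: (j \in B).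
  by rewrite qA qB.
(* In the last case all of [A] right of [q] is made unimodular first, and is then heavy enough to
   correct everything on the left. *)
have [|||y [k [yE Ny]]] := @exchange_base om (fun l r a b => ~~ a && b)
    (fun l r a b => [&& r, a & ~~ b]) eps om1 _ _ _ eps_le1.
- by case=> -[] [] [].
- by case=> -[] [] [].
- move: h1 cut_left cut_right wAB; have [-> ->] := weight_partT.
  have [a1 [i1 [b1 [a2 [i2 [b2 [z [[? ? ? ?] [? ? ?] E]]]]]]]] := weight_atoms.
  by rewrite !E qA qB /=; lra.
(* The first exchange loses control on [B] outside [A]. Large coefficients on the right, collected
   in [D], join the greedy set; the remaining ones are at most 1. *)
pose D := [fset j in part (fun l r a b => [&& r, ~~ a & b]) | 1 <= N (co j y)]%fset.
pose G := (part (fun l r a b => r && a) `|` D)%fset.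
have inG j : j \in G = [&& (j \in A) || (j \in B), (q < j)%N &
    (j \in A) || (1 <= N (co j y))].
  rewrite in_fsetU !in_part !inE /= !andbA.
  by case: (j \in A); case: (j \in B); case: (q < j)%N; rewrite /= ?orbF.
have [||||||z [k' [zE Nz]]] := @exch G (part (fun l r a b => l && (a || b))) y
    (fun j => if j \in A then eps j else 0) 1.
- move=> j; rewrite in_part inG => /and3P[_ qj _].
  by rewrite ltnNge (ltnW qj) /= andbF.
- apply: (le_trans (ltW h2)); apply: weight_subset => j.
  by rewrite in_part inG; case: (j \in A); case: (j \in B); rewrite ?andbF ?andbT.
- exact: ler01.
- move=> j; rewrite inG => /and3P[AB qj].
  case jA: (j \in A) => //= _; rewrite yE !in_part jA qj /=.
  by case: (j \in B); rewrite ?eps1 ?omE.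
- move=> j; rewrite inG in_part; case: (ltngtP j q) => jq /=.
  + by rewrite yE !in_part; case: (j \in A); case: (j \in B);
      rewrite //= (rnorm0 iP) ler01.
  + case jA: (j \in A) => //=; case jB: (j \in B) => //=.
      by rewrite -ltNge => /ltW.
    by rewrite yE !in_part jA jB /= (rnorm0 iP) ler01.
  + by rewrite jq yE !in_part qA qB ltnn /= omE.
- by move=> j _; case: ifP => _; rewrite ?eps1 ?(rnorm0 iP) ?ler01.
apply: (@cut_from_left z).
  by apply: (le_trans Nz); rewrite ler_wpM2l.
move=> j; rewrite zE inG in_part yE !in_part; case: (ltngtP j q) => [_ _|//|-> _] /=.
  by case: (j \in A); case: (j \in B).
by rewrite qA qB /= omq.
Qed.

Lemma cut_mem_left : q \in A -> q \notin B ->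
  N (lincomb e A eps) <= Kb * ((1 + Kb) * s + c ^+ 2) * sigma.
Proof.
move=> qA /negbTE qB.
have omE j : N (1 * eps' j) = 1 by rewrite mul1r eps'1.
(* If [B] on the right outweighs [q], it pays for [eps q]; then [B] on the left pays for [A] on the
   right. *)
have [h1|h1] := leP (W (fun l r a b => ~~ l && ~~ r)) (W (fun l r a b => r && b)).
  have [||y [k [yE Ny]]] := @exchange_base 1 (fun l r a b => r && b)
    (fun l r a b => ~~ l && ~~ r) eps (rnorm1 iP) _ _ h1 eps_le1.
  - by case=> -[] [] [].
  - by case=> -[] [] [].
  pose v := P q.+1 y.
  have vE j : co j v = if (j < q)%N then if j \in B then 1 * eps' j else 0
      else if j == q then eps q else 0.
    rewrite (coord_partial_sum hB) yE !in_part ltnS; case: (ltngtP j q) => // [_|->].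
      by case: (j \in A); case: (j \in B).
    by rewrite qA qB.
  have [||||||z [k' [zE Nz]]] := @exch
      (part (fun l r a b => l && b)) (part (fun l r a b => r && a)) v eps 1.
  - move=> j; rewrite !in_part; case: (ltngtP j q) => _;
      by case: (j \in A); case: (j \in B).
  - move: h1 cut_left cut_right wAB; have [-> ->] := weight_partT.
    have [a1 [i1 [b1 [a2 [i2 [b2 [z [[? ? ? ?] [? ? ?] E]]]]]]]] := weight_atoms.
    by rewrite !E qA qB /=; lra.
  - exact: ler01.
  - move=> j; rewrite in_part vE; case: (ltngtP j q) => _ /=; rewrite ?andbF //.
    by case: (j \in B); rewrite ?andbF // omE.
  - move=> j _ _; rewrite vE; do ?[case: ifP => _]; by rewrite ?omE ?(rnorm0 iP) ?ler01.
  - by move=> j _; exact: eps_le1.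
  apply: (@cut_from_right z).
    apply: (le_trans Nz); rewrite ler_wpM2l //; apply: (le_trans (hP _ _)).
    by rewrite ler_wpM2l.
  move=> j; rewrite zE vE !in_part; case: (ltngtP j q) => [//|_|-> _] /=.
    by case: (j \in A); case: (j \in B).
  by rewrite qA qB.
have [h2|h2] := leP (W (fun l r a b => ~~ l && a)) (W (fun l r a b => l && (a || b))).
  have wAB' : W (fun l r a b => l && a) <= W (fun l r a b => r && b).
    move: cut_left.
    have [a1 [i1 [b1 [a2 [i2 [b2 [z [_ _ E]]]]]]]] := weight_atoms.
    by rewrite !E qA qB /=; lra.
  have [||y [k [yE Ny]]] := @exchange_base 1 (fun l r a b => r && b)
    (fun l r a b => l && a) eps (rnorm1 iP) _ _ wAB' eps_le1.
  - by case=> -[] [] [].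
  - by case=> -[] [] [].
  pose v := P q y.
  have vE j : co j v = if (j < q)%N then if j \in A then eps j else
      if j \in B then 1 * eps' j else 0 else 0.
    rewrite (coord_partial_sum hB) yE !in_part; case: (ltngtP j q) => // _.
    by case: (j \in A); case: (j \in B).
  have [||||||z [k' [zE Nz]]] := @exch
      (part (fun l r a b => l && (a || b))) (part (fun l r a b => ~~ l && a)) v eps 1.
  - move=> j; rewrite !in_part; case: (ltngtP j q) => _;
      by case: (j \in A); case: (j \in B).
  - exact: h2.
  - exact: ler01.
  - move=> j; rewrite in_part vE; case: (ltngtP j q) => _ /=; rewrite ?andbF //.
    by case: (j \in A); case: (j \in B); rewrite //= ?eps1 ?omE.
  - move=> j _ _; rewrite vE; do ?[case: ifP => _];
      by rewrite ?omE ?eps1 ?(rnorm0 iP) ?ler01.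
  - by move=> j _; exact: eps_le1.
  apply: (@cut_from_right z).
    apply: (le_trans Nz); rewrite ler_wpM2l //; apply: (le_trans (hP _ _)).
    by rewrite ler_wpM2l.
  move=> j; rewrite zE vE !in_part; case: (ltngtP j q) => [//|_|-> _] /=.
    by case: (j \in A); case: (j \in B).
  by rewrite qA qB.
have [||| x [k [xE Nx]]] := @exchange_base 1 (fun l r a b => ~~ a && b)
    (fun l r a b => [&& ~~ l, a & ~~ b]) eps (rnorm1 iP) _ _ _ eps_le1.
- by case=> -[] [] [].
- by case=> -[] [] [].
- move: h1 cut_left cut_right wAB; have [-> ->] := weight_partT.
  have [a1 [i1 [b1 [a2 [i2 [b2 [z [[? ? ? ?] [? ? ?] E]]]]]]]] := weight_atoms.
  by rewrite !E qA qB /=; lra.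
(* Arbitrary coefficients of modulus at most 1 can be prescribed on the left part of the union: [A]
   from [q] on is unimodular in [x] and heavy enough, and [P q] discards the rest. *)
have left_ball (h : nat -> K) : (forall j, N (h j) <= 1) ->
    N (lincomb e (part (fun l r a b => l && (a || b))) h) <= Kb * (s * sigma).
  move=> h1'.
  pose D := [fset j in part (fun l r a b => [&& r, ~~ a & b]) | 1 <= N (co j x)]%fset.
  pose G := (part (fun l r a b => ~~ l && a) `|` D)%fset.
  have inG j : j \in G = [&& (j \in A) || (j \in B), ~~ (j < q)%N &
      (j \in A) || ((q < j)%N && (1 <= N (co j x)))].
    rewrite in_fsetU !in_part !inE /= !andbA.
    by case: (ltngtP j q) => _; case: (j \in A); case: (j \in B); rewrite /= ?orbF.
  have [||||||z [k' [zE Nz]]] := @exch G (part (fun l r a b => l && (a || b))) x h 1.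
  - by move=> j; rewrite in_part inG => /and3P[_ /negbTE -> _] /=; rewrite andbF.
  - apply: (le_trans (ltW h2)); apply: weight_subset => j.
    by rewrite in_part inG; case: (j \in A); case: (j \in B); rewrite ?andbF ?andbT.
  - exact: ler01.
  - move=> j; rewrite inG => /and3P[AB jq].
    case jA: (j \in A) => /= h3; last by case/andP: h3.
    by rewrite xE !in_part jA jq /=; case: (j \in B); rewrite //= ?eps1 ?omE.
  - move=> j; rewrite inG in_part; case: (ltngtP j q) => jq /=.
    + by rewrite xE !in_part; case: (j \in A); case: (j \in B);
        rewrite //= (rnorm0 iP) ler01.
    + case jA: (j \in A) => //=; case jB: (j \in B) => //=.
        by rewrite -ltNge => /ltW.
      by rewrite xE !in_part jA jB /= (rnorm0 iP) ler01.
    + by rewrite jq qA.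
  - by move=> j _; exact: h1'.
  have -> : lincomb e (part (fun l r a b => l && (a || b))) h = P q z.
    apply: (coord_ext hB) => j; rewrite (coord_lincomb hB) (coord_partial_sum hB) zE xE.
    rewrite inG !in_part; case: ltnP => _ //=; last by rewrite andbF.
    by case: (j \in A); case: (j \in B).
  apply: (le_trans (hP _ _)); rewrite ler_wpM2l //; apply: (le_trans Nz).
  by rewrite ler_wpM2l.
have wu : W (fun l r a b => r && a) <= W (fun l r a b => [&& l, ~~ a & b]).
  move: h1 cut_left cut_right wAB; have [-> ->] := weight_partT.
  have [a1 [i1 [b1 [a2 [i2 [b2 [z [[? ? ? ?] [? ? ?] E]]]]]]]] := weight_atoms.
  by rewrite !E qA qB /=; lra.
have [||y [g [yE Ny]]] := @exchange_base 1 (fun l r a b => [&& l, ~~ a & b])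
  (fun l r a b => r && a) eps (rnorm1 iP) _ _ wu eps_le1.
- by case=> -[] [] [].
- by case=> -[] [] [].
have [||y' [g' [y'E Ny']]] := @exchange_base (-1) (fun l r a b => [&& l, ~~ a & b])
  (fun l r a b => r && a) eps rnormN1 _ _ wu eps_le1.
- by case=> -[] [] [].
- by case=> -[] [] [].
(* The average has the right coefficients beyond [q], none at [q], and unknown ones only on [B]
   outside [A] left of [q]. *)
pose u := 2^-1 *: (y + y').
have Nu : N u <= sigma by exact: rnorm_half.
have uE j : co j u = if (j \in A) && (q < j)%N then eps j else
    if [&& (j < q)%N, j \notin A & j \in B] then 2^-1 * (g j + g' j) else 0.
  rewrite /u coordZ coordD yE y'E !in_part; case: (ltngtP j q) => [_|_|->].
  - case: (j \in A); case: (j \in B); rewrite //= ?addr0 ?mulr0 //.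
    by rewrite mul1r mulN1r subrr mulr0.
  - case: (j \in A); case: (j \in B); rewrite /= ?halfD ?addr0 ?mulr0 //.
    by rewrite mul1r mulN1r subrr mulr0.
  - by rewrite qA qB /= addr0 mulr0.
clearbody u.
have cs1 : 1 <= c * sigma.
  have [B0|/fset0Pn[n nB]] := eqVneq B fset0.
    move: wAB; rewrite B0 {2}/weight big_seq_fset0 leNgt => /negP; case.
    by rewrite /weight (big_fsetD1 q) //= ltr_wpDr // (weight_ge0 w_gt0).
  have := hc n (lincomb e B eps'); rewrite (coord_lincomb hB) nB eps'1 => h.
  apply: (le_trans h); rewrite ler_wpM2l ?(le_trans ler01) //.
  by rewrite /sigma ler_peMl.
have cs0 : 0 < c * sigma by exact: lt_le_trans cs1.
(* The coefficients of [u] are at most [c * sigma], so the fraction [lam] of its left part can be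
   cancelled inside [h]; subtracting [P q u] only pays for the fraction [1 - lam]. *)
pose lam := (c * sigma)^-1; have lam0 : 0 <= lam by rewrite invr_ge0 ltW.
pose h j := if j \in A then eps j else - (i lam * co j u).
have h_le1 j : N (h j) <= 1.
  rewrite /h; case: ifP => _; first by rewrite eps1.
  rewrite rnormN (rnormM iP) (rnorm_scalar iP) ger0_norm //.
  rewrite /lam mulrC ler_pdivrMr // mul1r; apply: (le_trans (hc _ _)).
  by rewrite ler_wpM2l // (le_trans ler01).
have -> : lincomb e A eps = lincomb e (part (fun l r a b => l && (a || b))) h +
    (u - i (1 - lam) *: P q u) + eps q *: e q.
  apply: (coord_ext hB) => j.
  rewrite !(coordD, coordN, coordZ) !(coord_lincomb hB) !(coord_partial_sum hB).
  rewrite (coord_basis hB) in_part /h uE rmorphB rmorph1.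
  case: (ltngtP j q) => [_|_|->].
  - by case: (j \in A); case: (j \in B); rewrite /=; ring.
  - by case: (j \in A); case: (j \in B); rewrite /=; ring.
  - by rewrite qA /= ?andbF /=; ring.
apply: (le_trans (ler_rnormD iP _ _)).
apply: (@le_trans _ _ (N (lincomb e (part (fun l r a b => l && (a || b))) h) +
  N (u - i (1 - lam) *: P q u) + N (eps q *: e q))).
  by rewrite lerD2r (ler_rnormD iP).
have lam1 : 0 <= 1 - lam by rewrite subr_ge0 invf_le1.
apply: (budget3 K1 s1 c1 cs1 (left_ball h h_le1)).
- apply: (le_trans (ler_rnormBD iP _ _)); apply: lerD => //.
  rewrite (rnormZ iP) (rnorm_scalar iP) ger0_norm // ler_wpM2l //.
  by apply: (le_trans (hP _ _)); rewrite ler_wpM2l.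
- by rewrite (rnormZ iP) eps1 mul1r.
Qed.

Lemma cut_bound : N (lincomb e A eps) <= Kb * s * ((1 + Kb) * s + c ^+ 2) * beta.
Proof.
have -> : Kb * s * ((1 + Kb) * s + c ^+ 2) * beta =
  Kb * ((1 + Kb) * s + c ^+ 2) * sigma by rewrite /sigma; ring.
case: (boolP (q \in A)) => [qA|]; last exact: cut_not_mem.
by case: (boolP (q \in B)); [exact: cut_mem_both | exact: cut_mem_left].
Qed.

End Cut.

Lemma semi_greedy_super_democratic : N (lincomb e A eps) <=
  Kb * s * ((1 + Kb) * s + c ^+ 2) * N (lincomb e B eps').
Proof.
have T0 : 0 <= Kb * s * ((1 + Kb) * s + c ^+ 2).
  by rewrite !mulr_ge0 ?addr_ge0 ?mulr_ge0 ?addr_ge0 ?exprn_ge0 ?(le_trans ler01).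
have [->|/fset0Pn[a aA]] := eqVneq A fset0.
  rewrite /lincomb big_seq_fset0 (rnorm0 iP) mulr_ge0 //; exact: (rnorm_ge0 iP).
(* At 0 the left part of [A] is empty; past all indices the right part of [B] is empty while [A] is
   not. So a crossing exists. *)
have [||q /andP[q1 q2]] := @nat_crossing (fun q =>
    weight w (part q (fun l r a b => l && a)) <=
    weight w (part q (fun l r a b => ~~ l && b))) (\max_(k <- (A `|` B)%fset) k).+1.
- apply: (@le_trans _ _ 0); last exact: (weight_ge0 w_gt0).
  by rewrite /weight big_seq big1 // => j; rewrite in_part ltn0 andbF.
- have jmax j : (j \in A) || (j \in B) -> (j < (\max_(k <- (A `|` B)%fset) k).+1)%N.
    by rewrite -in_fsetU ltnS => jU; exact: leq_bigmax_seq.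
  rewrite -ltNge; have -> : part (\max_(k <- (A `|` B)%fset) k).+1
      (fun l r a b => ~~ l && b) = fset0.
    apply/fsetP => j; rewrite in_part inE; case jU: (_ || _) => //=.
    by rewrite (jmax _ jU).
  rewrite {1}/weight big_seq_fset0 /weight (big_fsetD1 a) /=; last first.
    by rewrite in_part aA /= jmax ?aA.
  by rewrite ltr_wpDr // (weight_ge0 w_gt0).
apply: (cut_bound q1); move: q2; rewrite -ltNge.
have -> : part q.+1 (fun l r a b => ~~ l && b) = part q (fun l r a b => r && b).
  by apply/fsetP => j; rewrite !in_part ltnS -ltnNge.
have -> // : part q.+1 (fun l r a b => l && a) = part q (fun l r a b => ~~ r && a).
by apply/fsetP => j; rewrite !in_part ltnS -leqNgt.
Qed.

End SuperDemocracy.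

(** * Quasi-greedy democratic bases are semi-greedy *)

Section Converse.
Variables (R : realType) (K : numFieldType) (i : {rmorphism R -> K}).
Variables (re : K -> R).
Hypothesis iP : real_scalars i re.
Variables (X : completeNormedModType K).
Variables (e : nat -> X) (es : nat -> {linear X -> K^o}).
Hypothesis hB : schauder_basis e es.
Variable w : nat -> R.
Hypothesis w_gt0 : forall n, 0 < w n.

Local Notation N := (rnorm re).
Local Notation co := (coord es).

(** By density [v] is within [t / c] of a finite combination, and every coefficient of [v] off its
    support is smaller than [t]. *)
Lemma coord_level_set (v : X) (t : R) : 0 < t ->
  exists L : {fset nat}, forall n, (n \in L) = (t <= N (co n v)).
Proof.
move=> t0; have [c [Kb [_ _ he hc _]]] := basis_constants iP hB.
have c1 : 1 <= c by exact: (coord_constant_ge1 iP hB he hc).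
have c0 : 0 < c by exact: lt_le_trans c1.
case: (hB) => -[_ _ _ dense _] _.
have : closure (span_of e setT) v by rewrite dense.
have tc : 0 < i (t / c) by rewrite -(rmorph0 i) (scalar_lt iP) divr_gt0.
move=> /(_ _ (nbhsx_ballx v _ tc)) [_ [[A [a [_ ->]]]]].
rewrite -ball_normE /= -(scalar_rnorm iP) (scalar_lt iP) ltr_pdivlMr // mulrC => h.
exists [fset n in A | t <= N (co n v)]%fset => n; rewrite !inE /=.
case: (boolP (n \in A)) => //= nA; apply/esym/negbTE; rewrite -ltNge.
have -> : co n v = co n (v - lincomb e A a).
  by rewrite coordB (coord_lincomb hB) (negbTE nA) subr0.
by apply: le_lt_trans h; exact: hc.
Qed.

(* A coefficient of modulus [r <= 1] is the average of two opposite signs with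
   weights [(1 + r) / 2] and [(1 - r) / 2]. *)
Lemma lincomb_sign_bound (C : {fset nat}) (M : R) (h : nat -> K) :
  (forall eps, (forall n, N (eps n) = 1) -> N (lincomb e C eps) <= M) ->
  (forall n, N (h n) <= 1) -> N (lincomb e C h) <= M.
Proof.
move=> hM; suff gen (D : seq nat) : forall h : nat -> K, (forall n, N (h n) <= 1) ->
    (forall n, n \notin D -> N (h n) = 1) -> N (lincomb e C h) <= M.
  move=> h1; pose h' n := if n \in C then h n else 1.
  have -> : lincomb e C h = lincomb e C h'.
    by apply: (coord_ext hB) => n; rewrite !(coord_lincomb hB) /h'; case: (n \in C).
  apply: (gen (C : seq nat)) => n; rewrite /h'; first by case: ifP; rewrite ?(rnorm1 iP).
  by rewrite -[n \in (C : seq nat)]/(n \in C) => /negbTE ->; exact: (rnorm1 iP).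
elim: D {h} => [|a D IH] h h1 hD; first by apply: hM => n; exact: hD.
pose r := N (h a); pose g (z : K) n := if n == a then z else h n.
have Ng z : N z = 1 -> N (lincomb e C (g z)) <= M.
  move=> z1; apply: IH => n; rewrite /g; case: eqP => [_|/eqP na]; rewrite ?z1 //.
  by move=> nD; apply: hD; rewrite inE negb_or na.
have u1 : N (phase i re (h a)) = 1 by exact: (rnorm_phase iP).
have r0 : 0 <= r by exact: (rnorm_ge0 iP).
have r1 : r <= 1 by exact: h1.
have p0 : 0 <= (1 + r) / 2 by lra.
have m0 : 0 <= (1 - r) / 2 by lra.
have -> : lincomb e C h = i ((1 + r) / 2) *: lincomb e C (g (phase i re (h a))) +
    i ((1 - r) / 2) *: lincomb e C (g (- phase i re (h a))).
  apply: (coord_ext hB) => n; rewrite coordD !coordZ !(coord_lincomb hB).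
  case: (n \in C); last by ring.
  rewrite !(rmorphM i) !fmorphV !rmorphB !rmorphD !rmorph1 /g.
  case: eqP => [->|_]; last by field.
  by rewrite {1}[h a](phaseE iP) -/r; field.
apply: (le_trans (ler_rnormD iP _ _)).
rewrite !(rnormZ iP) !(rnorm_scalar iP) !ger0_norm //.
have -> : M = (1 + r) / 2 * M + (1 - r) / 2 * M by field.
by apply: lerD; rewrite ler_wpM2l // Ng // rnormN.
Qed.

(** * Consequences of quasi-greediness *)

Variable q : R.
Hypothesis q_gt0 : 0 < q.
Hypothesis hq : forall x m, (0 < m)%N -> N (x - greedy_sum e es m x) <= q * N x.

Let hq_set (A : {fset nat}) x : A != fset0 ->
  (forall a b, a \in A -> b \notin A -> greedy_before es x a b) ->
  N (x - lincomb e A (fun n => co n x)) <= q * N x.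
Proof.
move=> A0 hA; have := @hq x #|` A|; rewrite cardfs_gt0 A0 => /(_ isT).
by rewrite /greedy_sum (greedy_setE hA).
Qed.

(* If [q < 1], removing the terms of [e_0 + ... + e_n] one at a time makes the
   norm of [e_n] decay geometrically, while that of the whole sum is [O(n)]. *)
Lemma quasi_greedy_ge1 : 1 <= q.
Proof.
have [c [Kb [_ _ he hc _]]] := basis_constants iP hB.
have c1 : 1 <= c by exact: (coord_constant_ge1 iP hB he hc).
have c0 : 0 <= c by exact: le_trans c1.
rewrite leNgt; apply/negP => q1.
pose S n j := \sum_(j <= k < n.+1) e k.
have coS n j l : co l (S n j) = ((j <= l) && (l <= n))%N%:R.
  rewrite /S coord_sum; under eq_bigr do rewrite (coord_basis hB).
  rewrite (eq_bigr (fun k => if k == l then 1 else 0)) => [|k _]; last first.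
    by rewrite eq_sym; case: eqP.
  case: (boolP ((j <= l)%N && (l <= n)%N)) => h.
    rewrite (bigD1_seq l) ?iota_uniq ?mem_index_iota ?ltnS //= eqxx big1 ?addr0 //.
    by move=> k /negbTE ->.
  rewrite big_seq big1 // => k; rewrite mem_index_iota ltnS => hk.
  by case: eqP => // kl; rewrite -kl hk in h.
have step n j : (j <= n)%N -> N (S n j.+1) <= q * N (S n j).
  move=> jn; have -> : S n j.+1 = S n j -
      lincomb e [fset j]%fset (fun k => co k (S n j)).
    apply: (coord_ext hB) => l; rewrite coordB (coord_lincomb hB) !coS inE.
    by case: (ltngtP j l) => [_|_|<-]; rewrite /= ?subr0 // jn subrr.
  apply: hq_set => [|a b]; first by rewrite -cardfs_gt0 cardfs1.
  rewrite !inE => /eqP -> bj; apply/(greedy_beforeE iP); rewrite !coS leqnn jn /=.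
  rewrite (rnorm1 iP); case: (ltngtP j b) bj => //= jb _; last first.
    by left; rewrite (rnorm0 iP).
  by case: (b <= n)%N; [right; rewrite (rnorm1 iP) | left; rewrite (rnorm0 iP)].
have iter n j : (j <= n)%N -> N (S n j) <= q ^+ j * N (S n 0).
  elim: j => [_|j IH jn]; first by rewrite expr0 mul1r.
  apply: (le_trans (step _ _ (ltnW jn))); rewrite exprS -mulrA.
  by rewrite ler_wpM2l ?(ltW q_gt0) // IH // ltnW.
have bound n : 1 <= c ^+ 2 * (n.+1%:R * q ^+ n).
  have h1 : 1 <= c * N (S n n).
    by apply: (le_trans _ (hc n _)); rewrite coS leqnn (rnorm1 iP).
  apply: (le_trans h1); rewrite expr2 -mulrA ler_wpM2l //.
  apply: (le_trans (iter _ _ (leqnn n))).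
  have -> : c * (n.+1%:R * q ^+ n) = q ^+ n * (n.+1%:R * c) by ring.
  rewrite ler_wpM2l ?exprn_ge0 ?(ltW q_gt0) //.
  apply: (le_trans (ler_rnorm_sum iP _ _)).
  apply: (@le_trans _ _ (\sum_(0 <= k < n.+1) c)); first by apply: ler_sum => k _.
  by rewrite sumr_const_nat subn0 mulr_natl.
pose h := q^-1 - 1; have h0 : 0 < h by rewrite subr_gt0 invf_gt1.
have bernoulli m : 1 + m%:R * h <= (1 + h) ^+ m.
  elim: m => [|m IH]; first by rewrite mul0r addr0 expr0.
  rewrite exprS; apply: (@le_trans _ _ ((1 + h) * (1 + m%:R * h))).
    by have := ler0n R m; rewrite -natr1; nra.
  by rewrite ler_wpM2l // addr_ge0 // ltW.
(* With [k = m.+1], the bound at [n = 2 k] gives [(1 + k h)^2 <= c^2 (2 k + 1)] by Bernoulli. The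
   right side is at most [3 c^2 k], which [k > 3 c^2 / h^2] contradicts. *)
have [m hm] : exists m, 3 * c ^+ 2 / h ^+ 2 < m.+1%:R.
  exists (Num.Def.archi_bound (3 * c ^+ 2 / h ^+ 2)).
  apply: (lt_trans (archi_boundP _)); last by rewrite ltr_nat.
  by rewrite divr_ge0 ?mulr_ge0 ?exprn_ge0 // ltW.
have := bound (m.+1 * 2)%N; have hE : 1 + h = q^-1 by rewrite /h addrC subrK.
rewrite exprM; have := bernoulli m.+1; rewrite hE exprVn.
set x := q ^+ m.+1; have x0 : 0 < x by rewrite exprn_gt0.
move: hm; rewrite ltr_pdivrMr ?exprn_gt0 //.
have -> : (m.+1 * 2).+1%:R = m.+1%:R * 2 + 1 :> R by rewrite -addn1 natrD natrM.
have : 1 <= m.+1%:R :> R by rewrite ler1n.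
set k := m.+1%:R => k1 h3 h4 h5.
have h6 : (1 + k * h) * x <= 1 by rewrite -ler_pdivlMr // mul1r.
have h7 : (1 + k * h) ^+ 2 * (c ^+ 2 * ((k * 2 + 1) * x ^+ 2)) <= c ^+ 2 * (k * 2 + 1).
  have -> : (1 + k * h) ^+ 2 * (c ^+ 2 * ((k * 2 + 1) * x ^+ 2)) =
     (c ^+ 2 * (k * 2 + 1)) * ((1 + k * h) * x) ^+ 2 by ring.
  rewrite ler_piMr ?mulr_ge0 ?exprn_ge0 //; first by lra.
  rewrite exprn_ile1 // mulr_ge0 ?(ltW x0) // addr_ge0 // mulr_ge0 ?ltW //; lra.
have h8 : (1 + k * h) ^+ 2 <= c ^+ 2 * (k * 2 + 1).
  by apply: le_trans h7; rewrite ler_peMr // exprn_ge0 // addr_ge0 // mulr_ge0 ?(ltW h0) //; lra.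
have c2 : 0 <= c ^+ 2 by rewrite exprn_ge0.
have h9 : k * (3 * c ^+ 2) < k * (k * h ^+ 2) by rewrite ltr_pM2l //; lra.
have kh : 0 <= k * h by rewrite mulr_ge0 ?(ltW h0) //; lra.
have h10 : c ^+ 2 * (k * 2 + 1) <= k * (3 * c ^+ 2) by nra.
by nra.
Qed.

(** Strict inequalities leave no ties to break, and [1 <= q] covers the empty set. *)
Let hq_strict (A : {fset nat}) x :
  (forall a b, a \in A -> b \notin A -> N (co b x) < N (co a x)) ->
  N (x - lincomb e A (fun n => co n x)) <= q * N x.
Proof.
move=> hA; have [->|A0] := eqVneq A fset0.
  rewrite /lincomb big_seq_fset0 subr0 ler_peMl ?quasi_greedy_ge1 //.
  exact: (rnorm_ge0 iP).
by apply: hq_set => // a b aA bA; apply/(greedy_beforeE iP); left; exact: hA.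
Qed.

(* By Abel summation along the level sets of [v], the vector on the left is [t]
   times a convex combination of greedy remainders of [v]. *)
Lemma monotone_multiplier_bound (v : X) (A : {fset nat}) (lam : nat -> R) (t : R) :
  (forall a b, a \in A -> b \notin A -> N (co b v) < N (co a v)) ->
  (forall a, a \in A -> 0 <= lam a <= t) ->
  (forall a b, a \in A -> b \in A -> N (co a v) <= N (co b v) -> lam a <= lam b) ->
  0 <= t ->
  N (i t *: v - lincomb e A (fun n => i (lam n) * co n v)) <= t * (q * N v).
Proof.
have [n] := ubnP #|` A|; elim: n A lam t => // n IH A lam t /ltnSE cA hA lamt lam_mono t0.
have [A0|A0] := eqVneq A fset0.
  rewrite A0 /lincomb big_seq_fset0 subr0 (rnormZ iP) (rnorm_scalar iP) ger0_norm //.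
  by rewrite ler_wpM2l // ler_peMl ?quasi_greedy_ge1 // (rnorm_ge0 iP).
have [b bA bmin] := fset_argmin (fun n => N (co n v)) A0.
pose A' := [fset a in A | N (co b v) < N (co a v)]%fset.
have inA' a : (a \in A') = (a \in A) && (N (co b v) < N (co a v)) by rewrite !inE.
have b0 : 0 <= lam b by case/andP: (lamt _ bA).
(* The smallest multiplier [lam b] is split off as a multiple of the greedy remainder; on the lowest
   level of [A] nothing remains, so the induction continues with the smaller [A']. *)
have -> : i t *: v - lincomb e A (fun n => i (lam n) * co n v) =
    i (lam b) *: (v - lincomb e A (fun n => co n v)) +
    (i (t - lam b) *: v - lincomb e A' (fun n => i (lam n - lam b) * co n v)).
  apply: (coord_ext hB) => a; rewrite !(coordD, coordN, coordZ) !(coord_lincomb hB) inA'.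
  rewrite !rmorphB; case: (boolP (a \in A)) => aA /=; last by ring.
  case: ltP => h; first by ring.
  have -> : lam a = lam b by apply: le_anti; rewrite !lam_mono // bmin.
  by ring.
apply: (le_trans (ler_rnormD iP _ _)).
have -> : t * (q * N v) = lam b * (q * N v) + (t - lam b) * (q * N v) by ring.
apply: lerD.
  by rewrite (rnormZ iP) (rnorm_scalar iP) ger0_norm // ler_wpM2l // hq_strict.
apply: IH.
- apply: leq_trans cA; apply: fproper_ltn_card; rewrite fproperE; apply/andP; split.
    by apply/fsubsetP => a; rewrite inA' => /andP[].
  by apply/negP => /fsubsetP/(_ _ bA); rewrite inA' ltxx andbF.
- move=> a c; rewrite !inA' => /andP[aA ba]; rewrite negb_and -leNgt => /orP[cA'|cb].
    exact: hA.
  exact: le_lt_trans ba.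
- move=> a; rewrite inA' => /andP[aA ba]; rewrite subr_ge0 lerD2r.
  by case/andP: (lamt _ aA) => _ ->; rewrite lam_mono // ltW.
- move=> a c; rewrite !inA' => /andP[aA _] /andP[cA' _] h.
  by rewrite lerD2r lam_mono.
- by rewrite subr_ge0; case/andP: (lamt _ bA).
Qed.

(** * Truncation at a height *)

Section Truncation.
Variables (v : X) (t : R) (L : {fset nat}).
Hypotheses (t0 : 0 < t) (hL : forall n, (n \in L) = (t <= N (co n v))).

(** Coefficients of modulus at least [t] are shrunk to modulus [t] with unchanged phase. The form
    [1 - t / N (co n v)] exhibits a multiplier in [[0, 1]] that increases with the modulus. *)
Definition truncation : X :=
  v - lincomb e L (fun n => i (1 - t / N (co n v)) * co n v).

Lemma coord_truncation n : co n truncation =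
  if n \in L then i t * phase i re (co n v) else co n v.
Proof.
rewrite /truncation coordB (coord_lincomb hB); case: ifP => nL; last by rewrite subr0.
move: nL; rewrite hL => tn; have n0 : N (co n v) != 0 by rewrite gt_eqF // (lt_le_trans t0).
rewrite {1 3}[co n v](phaseE iP) rmorphB rmorph1 rmorphM fmorphV.
by field; rewrite fmorph_eq0.
Qed.

Lemma truncation_bound : N truncation <= q * N v.
Proof.
have := @monotone_multiplier_bound v L (fun n => 1 - t / N (co n v)) 1.
rewrite rmorph1 scale1r mul1r; apply => //.
- by move=> a b; rewrite !hL -ltNge => h1 h2; exact: lt_le_trans h1.
- move=> a; rewrite hL => h; have a0 := lt_le_trans t0 h.
  by rewrite subr_ge0 ler_pdivrMr // mul1r h gerBl divr_ge0 // ltW.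
- move=> a b; rewrite !hL => ha hb ab; rewrite lerD2l lerN2 ler_wpM2l ?(ltW t0) //.
  by rewrite lef_pV2 ?posrE // (lt_le_trans t0).
Qed.

Lemma coord_truncation_le n : N (co n truncation) <= t.
Proof.
rewrite coord_truncation; case: ifPn => [_|].
  by rewrite (rnormM iP) (rnorm_phase iP) (rnorm_scalar iP) mulr1 gtr0_norm.
by rewrite hL -ltNge => /ltW.
Qed.

(** The truncation and the greedy remainder after [L] agree off [L], and their difference is [t]
    times the phases on [L]. *)
Lemma phase_level_set_bound :
  t * N (lincomb e L (fun n => phase i re (co n v))) <= 2 * (q * N v).
Proof.
rewrite -[t in t * _](gtr0_norm t0) -(rnorm_scalar iP) -(rnormZ iP).
have -> : i t *: lincomb e L (fun n => phase i re (co n v)) =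
    truncation - (v - lincomb e L (fun n => co n v)).
  apply: (coord_ext hB) => n; rewrite coordZ coordB coord_truncation coordB.
  by rewrite !(coord_lincomb hB); case: (n \in L); ring.
apply: (le_trans (ler_rnormBD iP _ _)).
have h1 := truncation_bound.
have h2 : N (v - lincomb e L (fun n => co n v)) <= q * N v.
  by apply: hq_strict => a b; rewrite !hL -ltNge => h3 h4; exact: lt_le_trans h3.
by lra.
Qed.

End Truncation.

(** Inflating the coefficients on the complement of [E] in [L] by a factor [1 + d / M] makes that
    complement a greedy set with remainder [1_E]; then [d] tends to 0. *)
Lemma sign_subset_bound (E L : {fset nat}) (eps : nat -> K) :
  (E `<=` L)%fset -> (forall n, N (eps n) = 1) ->
  N (lincomb e E eps) <= q * N (lincomb e L eps).
Proof.
move=> /fsubsetP EL eps1; have q0 := ltW q_gt0.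
pose z := lincomb e (L `\` E)%fset eps.
apply/ler_addgt0Pr => d d0; pose M := q * N z + 1.
have M0 : 0 < M by rewrite ltr_wpDl // mulr_ge0 // (rnorm_ge0 iP).
have dM : 0 < d / M by rewrite divr_gt0.
pose x := lincomb e L eps + i (d / M) *: z.
have xE n : co n x = if n \in E then eps n else
    if n \in L then i (1 + d / M) * eps n else 0.
  rewrite coordD coordZ !(coord_lincomb hB) in_fsetD rmorphD rmorph1.
  case: (boolP (n \in E)) => [/EL ->|_] /=; first by ring.
  by case: (n \in L); ring.
have -> : lincomb e E eps = x - lincomb e (L `\` E)%fset (fun n => co n x).
  apply: (coord_ext hB) => n; rewrite coordB !(coord_lincomb hB) xE in_fsetD.
  by case: (boolP (n \in E)) => nE /=; case: (n \in L); ring.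
apply: (@le_trans _ _ (q * N x)).
  apply: hq_strict => a b; rewrite !in_fsetD !xE => /andP[/negbTE -> ->].
  rewrite (rnormM iP) eps1 mulr1 (rnorm_scalar iP) gtr0_norm ?addr_gt0 //.
  case: (boolP (b \in E)) => bE /=; first by rewrite eps1 ltrDl.
  by move/negbTE => ->; rewrite (rnorm0 iP) addr_gt0.
apply: (@le_trans _ _ (q * (N (lincomb e L eps) + d / M * N z))).
  rewrite ler_wpM2l //; apply: (le_trans (ler_rnormD iP _ _)).
  by rewrite (rnormZ iP) (rnorm_scalar iP) gtr0_norm.
rewrite mulrDr lerD2l mulrCA mulrAC ler_pdivrMr // ler_wpM2l ?(ltW d0) //.
by rewrite /M lerDl.
Qed.

(** The hypothesis with [E] inside [L] serves both converses: [D] is [Cs] under super-democracy, and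
    [Csd * Cq] under the disjoint version. *)
Lemma chebyshev_error_bound (D : R) (x y : X) (m : nat) : 0 <= D ->
  (forall (C E L : {fset nat}) (eps eps' : nat -> K), weight w C <= weight w E ->
    [disjoint C & E]%fset -> (E `<=` L)%fset ->
    (forall n, N (eps n) = 1) -> (forall n, N (eps' n) = 1) ->
    N (lincomb e C eps) <= D * N (lincomb e L eps')) ->
  is_chebyshev_greedy_sum e es m x y ->
  forall B b, weight w B <= weight w (greedy_set es m x) ->
  N (x - y) <= (q + 4 * q * D) * N (x - lincomb e B b).
Proof.
move=> D0 dem [[a0 yE] cheb] B b wB.
have q1 := quasi_greedy_ge1; have q0 := ltW q_gt0.
have cheb' a : N (x - y) <= N (x - lincomb e (greedy_set es m x) a).
  by rewrite -(le_rnorm iP).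
have qD : 0 <= q * D by exact: mulr_ge0.
have Cge1 : 1 <= q + 4 * q * D by lra.
pose v := x - lincomb e B b; have Nv : 0 <= N v by exact: (rnorm_ge0 iP).
set A := greedy_set es m x in wB cheb' yE *.
have [A0|A0] := eqVneq A fset0.
  have B0 : B = fset0.
    apply/eqP/negPn/negP => /fset0Pn[j jB]; move: wB.
    rewrite A0 {2}/weight big_seq_fset0 leNgt => /negP; apply.
    by rewrite /weight (big_fsetD1 j) //= ltr_wpDr // (weight_ge0 w_gt0).
  apply: (le_trans (cheb' (fun=> 0))).
  rewrite A0 /v B0 /lincomb !big_seq_fset0 ler_peMl //; exact: (rnorm_ge0 iP).
have gA : forall a b, a \in A -> b \notin A -> greedy_before es x a b.
  have : A <> fset0 by exact/eqP.
  by rewrite /A /greedy_set; case: xgetP => [_ -> []|].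
have [j0 j0A j0min] := fset_argmin (fun j => N (co j x)) A0.
have j0max j : j \notin A -> N (co j x) <= N (co j0 x).
  by move=> /(gA _ _ j0A)/(greedy_beforeE iP)[/ltW|[-> _]].
(* If the smallest coefficient on [A] is 0, then [x] is supported in [A] and the Chebyshev error is
   0. *)
have := rnorm_ge0 iP (co j0 x); rewrite le_eqVlt => /predU1P[x0|t0].
  apply: (le_trans (cheb' (fun n => co n x))).
  have -> : x - lincomb e A (fun n => co n x) = 0.
    apply: (coord_ext hB) => n; rewrite coordB (coord_lincomb hB) coord0.
    case: ifPn => [_|/j0max]; first by rewrite subrr.
    rewrite -x0 subr0 => h; apply: (rnorm0_eq0 iP); apply: le_anti.
    by rewrite h (rnorm_ge0 iP).
  by rewrite (rnorm0 iP) mulr_ge0 // (le_trans ler01).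
set t := N (co j0 x) in t0 j0min j0max.
have [L hL] := coord_level_set v t0.
have vE n : n \notin B -> co n v = co n x.
  by move=> nB; rewrite coordB (coord_lincomb hB) (negbTE nB) subr0.
pose T := truncation v t L.
have TE n : n \notin A -> n \notin B -> co n T = co n x.
  move=> nA nB; rewrite (coord_truncation t0 hL) hL vE //.
  case: leP => // tn; have -> : t = N (co n x) by apply: le_anti; rewrite tn j0max.
  by rewrite -(phaseE iP).
have Tle n : N (co n T) <= t := coord_truncation_le t0 hL n.
have h1 : N T <= q * N v := truncation_bound t0 hL.
clearbody T.
pose p := lincomb e L (fun n => phase i re (co n v)).
(* Off [A] and [B] the truncation already agrees with [x]; after correction on the rest of [B], [u]
   differs from [x] on [A] only. *)
pose u := T + lincomb e (B `\` A)%fset (fun n => co n x - co n T).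
have xu : x - lincomb e A (fun n => co n (x - u)) = u.
  apply: (coord_ext hB) => n; rewrite coordB (coord_lincomb hB).
  rewrite /u !(coordD, coordN) (coord_lincomb hB) in_fsetD.
  case: (boolP (n \in A)) => nA /=; first by ring.
  by case: (boolP (n \in B)) => nB /=; rewrite ?(TE _ nA nB); ring.
(* Removing the common part of [A] and [B] keeps the comparison of weights and makes the two sets
   disjoint. *)
have wBA : weight w (B `\` A)%fset <= weight w (A `\` B)%fset.
  have wI (C E : {fset nat}) :
      weight w C = weight w (C `&` E)%fset + weight w (C `\` E)%fset.
    rewrite {1}/weight (big_fsetID _ (mem E)) /=; congr (_ + _).
      by congr (weight w _); apply/fsetP => n; rewrite !inE.
    by congr (weight w _); apply/fsetP => n; rewrite !inE andbC.
  by move: wB; rewrite (wI B A) (wI A B) fsetIC lerD2l.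
have ABL : (A `\` B `<=` L)%fset.
  by apply/fsubsetP => n; rewrite in_fsetD hL => /andP[nB nA]; rewrite vE // j0min.
have dBA : [disjoint (B `\` A)%fset & (A `\` B)%fset]%fset.
  by apply/fdisjointP => n; rewrite !in_fsetD => /andP[/negbTE ->]; rewrite andbF.
have N2t : N (i (2 * t)) = 2 * t by rewrite (rnorm_scalar iP) gtr0_norm // mulr_gt0.
have t2 : i (2 * t) != 0 by rewrite fmorph_eq0 gt_eqF // mulr_gt0.
have hp : N (lincomb e (B `\` A)%fset (fun n => co n x - co n T)) <=
    2 * t * (D * N p).
  (* Off [A] both [x] and [T] have coefficients at most [t], so the corrections divided by [2 * t]
     have modulus at most 1. *)
  pose h n := if n \in (B `\` A)%fset then (co n x - co n T) / i (2 * t) else 0.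
  have -> : lincomb e (B `\` A)%fset (fun n => co n x - co n T) =
      i (2 * t) *: lincomb e (B `\` A)%fset h.
    apply: (coord_ext hB) => n; rewrite coordZ !(coord_lincomb hB) /h.
    by case: ifP => _; rewrite ?mulr0 // mulrC divfK.
  rewrite (rnormZ iP) N2t ler_wpM2l ?mulr_ge0 ?(ltW t0) //.
  apply: lincomb_sign_bound => [eps eps1|n].
    by apply: (dem _ (A `\` B)%fset) => // n; exact: (rnorm_phase iP).
  rewrite /h; case: ifP => [|_]; last by rewrite (rnorm0 iP).
  rewrite in_fsetD => /andP[nA nB].
  rewrite (rnormM iP) (rnormV iP) N2t ler_pdivrMr ?mulr_gt0 // mul1r.
  apply: (le_trans (ler_rnormBD iP _ _)).
  by have := j0max _ nA; have := Tle n; lra.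
apply: (le_trans (cheb' (fun n => co n (x - u)))); rewrite xu.
apply: (le_trans (ler_rnormD iP _ _)).
have h2 : t * N p <= 2 * (q * N v) := phase_level_set_bound t0 hL.
have h3 := ler_wpM2l D0 h2.
by rewrite -/v; nra.
Qed.

End Converse.

(** * Least constants *)

Section LeastConstants.
Variables (R : realType) (K : numFieldType) (i : {rmorphism R -> K}).
Variables (re : K -> R).
Hypothesis iP : real_scalars i re.
Variables (X : completeNormedModType K).
Variables (e : nat -> X) (es : nat -> {linear X -> K^o}).
Hypothesis hB : schauder_basis e es.
Variable w : nat -> R.
Hypothesis w_gt0 : forall n, 0 < w n.

Local Notation N := (rnorm re).
Local Notation co := (coord es).

Let i_le x y : (i x <= i y) = (x <= y). Proof. by case: iP => ->. Qed.

Lemma positive_scalar (C : K) : 0 < C -> exists2 r : R, C = i r & 0 < r.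
Proof.
move=> C0; exists (re C); first by rewrite (scalar_re iP) // gtr0_real.
by rewrite -(scalar_lt iP) rmorph0 (scalar_re iP) // gtr0_real.
Qed.

Lemma is_signE (eps : nat -> K) : is_sign eps <-> forall n, N (eps n) = 1.
Proof.
split=> h n; first by rewrite /rnorm h -(rmorph1 i) (re_scalar iP).
by rewrite -(scalar_rnorm iP) h rmorph1.
Qed.

Lemma quasi_greedy_real (C : R) : quasi_greedy_constants e es (i C) <->
  0 < C /\ forall x m, (0 < m)%N -> N (x - greedy_sum e es m x) <= C * N x.
Proof.
by split=> -[C0 h]; split; rewrite -?(scalar_lt iP) ?rmorph0 // in C0 *;
  move=> x m /(h x m); rewrite -?i_le rmorphM !(scalar_rnorm iP).
Qed.

Lemma super_democratic_real (C : R) : super_democratic_constants e w (i C) <->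
  0 < C /\ forall (A B : {fset nat}) eps eps', weight w A <= weight w B ->
    (forall n, N (eps n) = 1) -> (forall n, N (eps' n) = 1) ->
    N (lincomb e A eps) <= C * N (lincomb e B eps').
Proof.
split=> -[C0 h]; split; rewrite -?(scalar_lt iP) ?rmorph0 // in C0 *.
  move=> A B eps eps' AB /is_signE s1 /is_signE s2.
  by rewrite -i_le rmorphM !(scalar_rnorm iP); exact: h.
move=> A B eps eps' AB /is_signE s1 /is_signE s2.
by rewrite -!(scalar_rnorm iP) -rmorphM i_le; exact: h.
Qed.

Lemma quasi_greedy_least (C0 : R) : 0 < C0 ->
  (forall x m, (0 < m)%N -> N (x - greedy_sum e es m x) <= C0 * N x) ->
  exists2 c, c <= C0 & is_least (quasi_greedy_constants e es) (i c).
Proof.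
move=> C00 hC0.
have [|//|||c cC0 cl] := @least_constant _ _ _ _ iP (X * nat)%type
    (fun t => (0 < t.2)%N) (fun t => N (t.1 - greedy_sum e es t.2 t.1))
    (fun t => N t.1) C0.
- by move=> t; exact: (rnorm_ge0 iP).
- by move=> [x m]; exact: hC0.
- exists (e 0 + e 1, 1%N) => //=.
  rewrite lt_def (rnorm_ge0 iP) andbT; apply/eqP => /(rnorm0_eq0 iP)/(congr1 (co 1)).
  rewrite coordB coordD !(coord_basis hB) coord0 /greedy_sum (greedy_set_pair iP hB).
  by rewrite (coord_lincomb hB) inE /= => /eqP; rewrite add0r subr0 oner_eq0.
exists c => //; congr (is_least _ _): cl; apply/seteqP; split=> C [C1 h]; split => //.
  by move=> x m m0; have := h (x, m) m0; rewrite !(scalar_rnorm iP).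
by move=> [x m] m0; rewrite !(scalar_rnorm iP); exact: h.
Qed.

Lemma super_democratic_least (C0 : R) : 0 < C0 ->
  (forall (A B : {fset nat}) eps eps', weight w A <= weight w B ->
    (forall n, N (eps n) = 1) -> (forall n, N (eps' n) = 1) ->
    N (lincomb e A eps) <= C0 * N (lincomb e B eps')) ->
  exists2 c, c <= C0 & is_least (super_democratic_constants e w) (i c).
Proof.
move=> C00 hC0.
have [|//|||c cC0 cl] := @least_constant _ _ _ _ iP
    ({fset nat} * {fset nat} * (nat -> K) * (nat -> K))%type
    (fun t => [/\ weight w t.1.1.1 <= weight w t.1.1.2, is_sign t.1.2 & is_sign t.2])
    (fun t => N (lincomb e t.1.1.1 t.1.2)) (fun t => N (lincomb e t.1.1.2 t.2)) C0.
- by move=> t; exact: (rnorm_ge0 iP).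
- by move=> [[[A B] eps] eps'] /= [AB /is_signE s1 /is_signE s2]; exact: hC0.
- exists ([fset 0%N], [fset 0%N], fun=> 1, fun=> 1)%fset => /=.
    by split => // n; exact: normr1.
  rewrite lt_def (rnorm_ge0 iP) andbT; apply/eqP => /(rnorm0_eq0 iP)/(congr1 (co 0)).
  by rewrite (coord_lincomb hB) coord0 inE => /eqP; rewrite oner_eq0.
exists c => //; congr (is_least _ _): cl; apply/seteqP; split=> C [C1 h]; split => //.
  move=> A B eps eps' AB s1 s2; have := h (A, B, eps, eps').
  by rewrite !(scalar_rnorm iP); apply.
by move=> [[[A B] eps] eps'] [AB s1 s2]; rewrite !(scalar_rnorm iP); exact: h.
Qed.

(** Dividing by [C0] turns an estimate against every competitor into a lower bound for their errors,
    hence for the infimum [sigma]. *)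
Lemma semi_greedy_least (C0 : R) : 0 < C0 ->
  (forall x y m, (0 < m)%N -> is_chebyshev_greedy_sum e es m x y ->
    forall A a, weight w A <= weight w (greedy_set es m x) ->
    N (x - y) <= C0 * N (x - lincomb e A a)) ->
  exists2 c, c <= C0 & is_least (semi_greedy_constants e es w) (i c).
Proof.
move=> C00 hC0.
pose sig (t : X * X * nat) := re (sigma e w (weight w (greedy_set es t.2 t.1.1)) t.1.1).
have sigP t : [/\ sigma e w (weight w (greedy_set es t.2 t.1.1)) t.1.1 = i (sig t),
    0 <= sig t &
    forall M, (forall A a, weight w A <= weight w (greedy_set es t.2 t.1.1) ->
      M <= N (t.1.1 - lincomb e A a)) -> M <= sig t].
  have [r [rE r0 _ r1]] := sigma_real iP e w t.1.1
    (weight_ge0 w_gt0 (greedy_set es t.2 t.1.1)).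
  by rewrite /sig rE (re_scalar iP).
have [|//|||c cC0 cl] := @least_constant _ _ _ _ iP (X * X * nat)%type
    (fun t => (0 < t.2)%N /\ is_chebyshev_greedy_sum e es t.2 t.1.1 t.1.2)
    (fun t => N (t.1.1 - t.1.2)) sig C0.
- by move=> t; case: (sigP t).
- move=> [[x y] m] /= [m0 cy]; case: (sigP (x, y, m)) => _ _ /= h.
  rewrite mulrC -ler_pdivrMr //; apply: h => A a wA.
  by rewrite ler_pdivrMr // mulrC; exact: hC0 wA.
- by have [y cy Ny] := chebyshev_pair iP hB; exists (e 0 + e 1, y, 1%N).
exists c => //; congr (is_least _ _): cl; apply/seteqP; split=> C [C1 h]; split => //.
  move=> x y m m0 cy; have := h (x, y, m) (conj m0 cy).
  by case: (sigP (x, y, m)) => /= <- _ _; rewrite (scalar_rnorm iP).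
move=> [[x y] m] [m0 cy]; case: (sigP (x, y, m)) => /= <- _ _.
by rewrite (scalar_rnorm iP); exact: h.
Qed.

Lemma semi_greedy_characterization :
  let c2 := basis_c2 e es in
  let Kb := basis_constant e es in
  [/\ forall Csg : K, is_least (semi_greedy_constants e es w) Csg ->
        exists Cq Cs : K,
          [/\ is_least (quasi_greedy_constants e es) Cq,
              is_least (super_democratic_constants e w) Cs,
              Cq <= Csg * Kb * (1 + (1 + Kb) * Csg + c2 ^+ 2) &
              Cs <= Kb * Csg * ((1 + Kb) * Csg + c2 ^+ 2)],
      forall Cq Cs : K, is_least (quasi_greedy_constants e es) Cq ->
        is_least (super_democratic_constants e w) Cs ->
        exists Csg : K,
          is_least (semi_greedy_constants e es w) Csg /\
          Csg <= Cq + 4 * Cq * Cs &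
      forall Cq Csd : K, is_least (quasi_greedy_constants e es) Cq ->
        is_least (disjoint_super_democratic_constants e w) Csd ->
        exists Csg : K,
          is_least (semi_greedy_constants e es w) Csg /\
          Csg <= Cq + 4 * Cq ^+ 2 * Csd].
Proof.
move=> c2 Kb'.
have [c [Kb [cE KE he hc hP]]] := basis_constants iP hB.
have c1 : 1 <= c := coord_constant_ge1 iP hB he hc.
have K1 : 1 <= Kb := basis_constant_ge1 iP hB he hc hP.
split.
- move=> Csg [sg _]; case: (sg) => /positive_scalar[s sE s0'] _; rewrite sE in sg *.
  have s1 : 1 <= s := semi_greedy_ge1 iP hB w_gt0 sg.
  have s0 : 0 <= s by exact: le_trans s1.
  have Kpos : 0 < Kb by exact: lt_le_trans K1.
  (* The constant [(1 + 2 * Kb) * s] lies below the stated one because [Kb], [s] and [c] are at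
     least 1. *)
  have [|x m _|q qle ql] := @quasi_greedy_least ((1 + 2 * Kb) * s).
  + by rewrite mulr_gt0 // addr_gt0 // mulr_gt0.
  + exact: (semi_greedy_quasi_greedy iP hB w_gt0 he hc hP sg).
  have [|A B eps eps' wAB eps1 eps'1|d dle dl] :=
      @super_democratic_least (Kb * s * ((1 + Kb) * s + c ^+ 2)).
  + have h : 0 < (1 + Kb) * s by rewrite mulr_gt0 // addr_gt0.
    by rewrite !mulr_gt0 // ltr_wpDr // exprn_ge0 // (le_trans ler01).
  + exact: (semi_greedy_super_democratic iP hB w_gt0 he hc hP sg wAB eps1 eps'1).
  exists (i q), (i d); split => //; rewrite /c2 /Kb' cE KE.
    have -> : i s * i Kb * (1 + (1 + i Kb) * i s + i c ^+ 2) =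
      i (s * Kb * (1 + (1 + Kb) * s + c ^+ 2)).
      by rewrite !(rmorphM, rmorphD, rmorphXn, rmorph1).
    rewrite i_le; apply: (le_trans qle).
    have -> : s * Kb * (1 + (1 + Kb) * s + c ^+ 2) =
       (Kb * (1 + (1 + Kb) * s + c ^+ 2)) * s by ring.
    have c21 : 1 <= c ^+ 2 by rewrite exprn_ege1.
    by rewrite ler_wpM2r //; nra.
  have -> : i Kb * i s * ((1 + i Kb) * i s + i c ^+ 2) =
    i (Kb * s * ((1 + Kb) * s + c ^+ 2)).
    by rewrite !(rmorphM, rmorphD, rmorphXn, rmorph1).
  by rewrite i_le.
- move=> Cq Cs [Hq _] [Hs _].
  case: (Hq) => /positive_scalar[q qE q0] _; case: (Hs) => /positive_scalar[d dE d0] _.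
  rewrite qE in Hq *; rewrite dE in Hs *.
  have [_ hq] := (quasi_greedy_real q).1 Hq.
  have [_ hs] := (super_democratic_real d).1 Hs.
  have [||c0 cle cl] := @semi_greedy_least (q + 4 * q * d).
  + by rewrite addr_gt0 // !mulr_gt0.
  + move=> x y m m0 cy A a wA.
    apply: (chebyshev_error_bound iP hB w_gt0 q0 hq (ltW d0) _ cy a wA).
    move=> C E L eps eps' wCE _ /fsubsetP EL s1 s2; apply: hs => //.
    by apply: (le_trans wCE); exact: (weight_subset w_gt0).
  exists (i c0); split => //; have -> : i q + 4 * i q * i d = i (q + 4 * q * d).
    by rewrite rmorphD !rmorphM rmorph_nat.
  by rewrite i_le.
- move=> Cq Csd [Hq _] [Hs _].
  case: (Hq) => /positive_scalar[q qE q0] _; case: (Hs) => /positive_scalar[d dE d0] hs.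
  rewrite qE in Hq *; rewrite dE in hs *.
  have [_ hq] := (quasi_greedy_real q).1 Hq.
  (* The extra factor [q] comes from passing from [E] to the larger set [L], which need not be
     disjoint from [C]. *)
  have [||c0 cle cl] := @semi_greedy_least (q + 4 * q * (d * q)).
  + by rewrite addr_gt0 // !mulr_gt0.
  + move=> x y m m0 cy A a wA.
    apply: (chebyshev_error_bound iP hB w_gt0 q0 hq _ _ cy a wA).
      by rewrite mulr_ge0 // ltW.
    move=> C E L eps eps' wCE dCE EL s1 s2.
    apply: (@le_trans _ _ (d * N (lincomb e E eps'))).
      by rewrite -i_le rmorphM !(scalar_rnorm iP); apply: hs => //; exact/is_signE.
    rewrite -mulrA ler_wpM2l ?(ltW d0) //.
    exact: (sign_subset_bound iP hB q0 hq EL s2).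
  exists (i c0); split => //; have -> : i q + 4 * i q ^+ 2 * i d = i (q + 4 * q * (d * q)).
    by rewrite rmorphD !rmorphM rmorph_nat; ring.
  by rewrite i_le.
Qed.

End LeastConstants.

Unset Implicit Arguments.

Theorem theorem1p11 (R : realType) (K : numFieldType)
  (hK : K = R :> numFieldType \/ K = R[i]%C :> numFieldType)
  (X : completeNormedModType K)
  (e : nat -> X) (es : nat -> {linear X -> K^o})
  (w : nat -> R) (hw : forall n, 0 < w n)
  (hB : schauder_basis e es) :
  let c2 := basis_c2 e es in
  let Kb := basis_constant e es in
  [/\ forall Csg : K, is_least (semi_greedy_constants e es w) Csg ->
        exists Cq Cs : K,
          [/\ is_least (quasi_greedy_constants e es) Cq,
              is_least (super_democratic_constants e w) Cs,
              Cq <= Csg * Kb * (1 + (1 + Kb) * Csg + c2 ^+ 2) &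
              Cs <= Kb * Csg * ((1 + Kb) * Csg + c2 ^+ 2)],
      forall Cq Cs : K, is_least (quasi_greedy_constants e es) Cq ->
        is_least (super_democratic_constants e w) Cs ->
        exists Csg : K,
          is_least (semi_greedy_constants e es w) Csg /\
          Csg <= Cq + 4 * Cq * Cs &
      forall Cq Csd : K, is_least (quasi_greedy_constants e es) Cq ->
        is_least (disjoint_super_democratic_constants e w) Csd ->
        exists Csg : K,
          is_least (semi_greedy_constants e es w) Csg /\
          Csg <= Cq + 4 * Cq ^+ 2 * Csd].
Proof.
by case: hK => KE; subst K;
  [have [i [re iP]] := real_scalars_real R | have [i [re iP]] := real_scalars_complex R];
  exact: (semi_greedy_characterization iP hB hw).
Qed.
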